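(* Let $n\ge1$ and $\mu,\nu,\lambda\in\mathsf{Par}_n$ such that $|\mu|+|\nu|+|\lambda|$ is even and, for every $(A,A',B,B',C,C')\in\mathcal{G}_n$, $$0\leq \sum_{i\in A} \mu_i - \sum_{i\in A'} \mu_i + \sum_{j\in B} \nu_j - \sum_{j\in B'} \nu_j + \sum_{k\in C} \lambda_k - \sum_{k\in C'} \lambda_k .$$ Suppose at least one of $\mu,\nu,\lambda$ is a single row (a partition of the form $(p,0,\dots,0)$) or a single column (a partition of the form $(1,\dots,1,0,\dots,0)$). Then $N_{\mu,\nu,\lambda}>0$.
   Context: $\mathsf{Par}_n=\{(\lambda_1,\dots,\lambda_n)\in\mathbb{Z}_{\ge0}^n:\lambda_1\ge\cdots\ge\lambda_n\}$, $|\lambda|=\sum_i\lambda_i$, and $[n]=\{1,\dots,n\}$. $c^{\gamma}_{\alpha,\beta}$ denotes the Littlewood–Richardson coefficient (partitions identified up to trailing zeros). The Newell–Littlewood number is $N_{\mu,\nu,\lambda}=\sum_{\alpha,\beta,\gamma} c^{\mu}_{\alpha,\beta}c^{\nu}_{\alpha,\gamma}c^{\lambda}_{\beta,\gamma}$ over all partitions $\alpha,\beta,\gamma$. For a finite set $I=\{i_1<\cdots<i_d\}\subseteq\mathbb{Z}_{>0}$, $\tau(I)=(i_d-d\ge\cdots\ge i_2-2\ge i_1-1)$. $\mathcal{G}_n$ is the set of tuples $(A,A',B,B',C,C')$ of subsets of $[n]$ such that: (I) $A\cap A'=B\cap B'=C\cap C'=\emptyset$; (II) $|A|=|B'|+|C'|$,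 $|B|=|A'|+|C'|$, $|C|=|A'|+|B'|$; (III) there exist $A_1,A_2,B_1,B_2,C_1,C_2\subseteq[n]$ with (1) $|A_1|=|A_2|=|A'|$, $|B_1|=|B_2|=|B'|$, $|C_1|=|C_2|=|C'|$; (2) $c^{\tau(A')}_{\tau(A_1),\tau(A_2)}, c^{\tau(B')}_{\tau(B_1),\tau(B_2)}, c^{\tau(C')}_{\tau(C_1),\tau(C_2)}>0$; (3) $c^{\tau(A)}_{\tau(B_1),\tau(C_2)}, c^{\tau(B)}_{\tau(C_1),\tau(A_2)}, c^{\tau(C)}_{\tau(A_1),\tau(B_2)}>0$. *)

(* Defs.v *)
From mathcomp Require Import all_boot all_order all_algebra.

Set Implicit Arguments.
Unset Strict Implicit.
Unset Printing Implicit Defensive.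

(* A partition is a weakly decreasing sequence of naturals; trailing zeros are
   allowed, and the i-th part (counted from 0) is [nth 0 s i].  Elements of
   Par_n are the weakly decreasing n-tuples. *)
Definition is_part (s : seq nat) : bool := sorted geq s.

Section LittlewoodRichardson.

(* A filling of the skew shape ga / al with entries in {1, ..., size be} is a
   function on the bounding rectangle of ga, with value 0 exactly at the cells
   outside ga / al. *)
Variables (al be ga : seq nat).
Let cell : finType := ('I_(size ga) * 'I_(head 0 ga))%type.
Variable T : {ffun cell -> 'I_(size be).+1}.

Definition skew_filling : bool :=
  [forall c : cell, (0 < T c) == (nth 0 al c.1 <= c.2 < nth 0 ga c.1)].

Definition row_weak : bool :=
  [forall c : cell, forall d : cell,
    [&& c.1 == d.1, c.2 <= d.2, 0 < T c & 0 < T d] ==> (T c <= T d)].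

Definition col_strict : bool :=
  [forall c : cell, forall d : cell,
    [&& c.2 == d.2, c.1 < d.1, 0 < T c & 0 < T d] ==> (T c < T d)].

Definition has_content : bool :=
  [forall k : 'I_(size be), #|[set c | T c == k.+1 :> nat]| == nth 0 be k].

(* The reading word runs through the rows from top to bottom, each one from
   right to left. *)
Definition read_before (d c : cell) : bool :=
  (d.1 < c.1) || ((d.1 == c.1) && (c.2 <= d.2)).

Definition ballot : bool :=
  [forall c : cell, forall k : 'I_(size be), (0 < k) ==>
    (#|[set d | read_before d c && (T d == k.+1 :> nat)]|
       <= #|[set d | read_before d c && (T d == k :> nat)]|)].

Definition LR_tableau : bool :=
  [&& skew_filling, row_weak, col_strict, has_content & ballot].

End LittlewoodRichardson.

Definition part_sub (al ga : seq nat) : bool :=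
  [forall i : 'I_(size al), nth 0 al i <= nth 0 ga i].

(* c^ga_(al, be): the number of Littlewood-Richardson tableaux of shape
   ga / al and content be. *)
Definition LRcoef (al be ga : seq nat) : nat :=
  if part_sub al ga then #|[set T | @LR_tableau al be ga T]| else 0.

Lemma part_subP al ga :
  reflect (forall i, nth 0 al i <= nth 0 ga i) (part_sub al ga).
Proof.
apply: (iffP forallP) => [H i|H i]; last exact: H.
by case: (ltnP i (size al)) => [lt_i|/(nth_default 0) -> //]; exact: (H (Ordinal lt_i)).
Qed.

Lemma is_part_nth s i j : is_part s -> i <= j -> nth 0 s j <= nth 0 s i.
Proof.
move=> ps le_ij; case: (ltnP j (size s)) => [lt_j|/(nth_default 0) -> //].
have tr : transitive geq by move=> y x z /= xy yz; exact: leq_trans yz xy.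
by apply: (sorted_leq_nth tr leqnn 0 ps) => //; rewrite inE // (leq_ltn_trans le_ij).
Qed.

Lemma LR_tableau_le_row al be ga T : @LR_tableau al be ga T ->
  forall c, T c <= c.1.+1.
Proof.
case/and5P=> _ /forallP Trow _ _ /forallP Tbal [i j].
have [m] := ubnP (nat_of_ord i); elim: m => // m IH in i j * => le_im /=.
rewrite leqNgt; apply/negP => lt_iT.
case E : (nat_of_ord (T (i, j))) lt_iT => [//|k]; rewrite ltnS => lt_ik.
have k_be : k < size be by rewrite -ltnS -E ltn_ord.
have /implyP/(_ (leq_ltn_trans (leq0n i) lt_ik)) :=
  forallP (Tbal (i, j)) (Ordinal k_be).
have p0 : 0 < #|[set d | read_before d (i, j) && (T d == k.+1 :> nat)]|.
  by apply/card_gt0P; exists (i, j); rewrite inE /read_before /= eqxx leqnn orbT E eqxx.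
move=> le_kk; have {p0 le_kk} := leq_trans p0 le_kk.
case/card_gt0P=> -[i' j']; rewrite inE /read_before /= => /andP[bef /eqP Tk].
case/orP: bef => [lt_i|].
  have := IH i' j' (leq_trans lt_i le_im); rewrite /= Tk => le_k.
  by have := leq_trans lt_ik le_k; rewrite ltnS leqNgt lt_i.
case/andP=> /eqP ei le_j; rewrite {i'}ei in Tk.
have /implyP := forallP (Trow (i, j)) (i, j').
rewrite /= eqxx le_j E Tk (leq_ltn_trans (leq0n i) lt_ik) /= => /(_ isT).
by rewrite ltnn.
Qed.

(* Hence in the sum defining the Newell-Littlewood number only the al and be
   contained in mu and the ga contained in nu contribute. *)
Lemma LRcoef_gt0_sub al be ga : is_part ga -> 0 < LRcoef al be ga ->
  part_sub al ga && part_sub be ga.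
Proof.
move=> pga; rewrite /LRcoef; case: ifP => //= _ /card_gt0P[T]; rewrite inE => LT.
have le_row := LR_tableau_le_row LT.
case/and5P: LT => /forallP Tsh _ /forallP Tcol /forallP Tcnt _.
apply/forallP=> k; rewrite -(eqP (Tcnt k)).
have inj2 : {in [set c | T c == k.+1 :> nat] &, injective snd}.
  move=> [i j] [i' j']; rewrite !inE /= => /eqP Tc /eqP Td ej; rewrite -{}ej in Td *.
  case: (ltngtP i i') => [lt_i|lt_i|/val_inj-> //].
    by have /implyP := forallP (Tcol (i, j)) (i', j); rewrite /= eqxx lt_i Tc Td ltnn => /(_ isT).
  by have /implyP := forallP (Tcol (i', j)) (i, j); rewrite /= eqxx lt_i Tc Td ltnn => /(_ isT).
rewrite -(card_in_imset inj2) -[leqRHS]card_ord.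
have -> : #|'I_(nth 0 ga k)| = size (iota 0 (nth 0 ga k)) by rewrite card_ord size_iota.
rewrite cardE -(size_map val); apply: uniq_leq_size.
  by rewrite (map_inj_uniq val_inj) enum_uniq.
move=> x /mapP[j]; rewrite mem_enum => /imsetP[[i j']]; rewrite inE => /eqP Tc /= -> -> {x j}.
rewrite mem_iota /= add0n.
have := Tsh (i, j'); rewrite Tc /= => /eqP/esym/andP[_ lt_j].
apply: leq_trans lt_j (is_part_nth pga _).
by have := le_row (i, j'); rewrite Tc.
Qed.

Definition bounded_part (m b : nat) : pred (m.-tuple 'I_b.+1) :=
  fun t => is_part (map val t).

(* N_(mu, nu, la).  By LRcoef_gt0_sub, nonzero terms require al, be to be
   contained in mu and ga in nu, so that, padding with zeros, it is enough to
   let al, be have size mu parts of value at most |mu|, and likewise for ga. *)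
Definition NL (mu nu la : seq nat) : nat :=
  \sum_(al : (size mu).-tuple 'I_(sumn mu).+1 | bounded_part al)
  \sum_(be : (size mu).-tuple 'I_(sumn mu).+1 | bounded_part be)
  \sum_(ga : (size nu).-tuple 'I_(sumn nu).+1 | bounded_part ga)
    LRcoef (map val al) (map val be) mu
    * LRcoef (map val al) (map val ga) nu
    * LRcoef (map val be) (map val ga) la.

(* [n] is represented by 'I_n, the ordinal i standing for i + 1; [enum I] is
   increasing, and the subtraction below is never truncated. *)
Definition tau (n : nat) (I : {set 'I_n}) : seq nat :=
  let s := [seq (val i).+1 | i <- enum I] in
  rev [seq nth 0 s k - k.+1 | k <- iota 0 (size s)].

Definition in_G (n : nat) (A A' B B' C C' : {set 'I_n}) : Prop :=
  [/\ [/\ A :&: A' = set0, B :&: B' = set0 & C :&: C' = set0],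
      [/\ #|A| = #|B'| + #|C'|, #|B| = #|A'| + #|C'| & #|C| = #|A'| + #|B'|]
    & exists A1 A2 B1 B2 C1 C2 : {set 'I_n},
      [/\ [/\ #|A1| = #|A'|, #|A2| = #|A'|, #|B1| = #|B'| & #|B2| = #|B'|],
          #|C1| = #|C'| /\ #|C2| = #|C'|,
          [/\ 0 < LRcoef (tau A1) (tau A2) (tau A'),
              0 < LRcoef (tau B1) (tau B2) (tau B')
            & 0 < LRcoef (tau C1) (tau C2) (tau C')]
        & [/\ 0 < LRcoef (tau B1) (tau C2) (tau A),
              0 < LRcoef (tau C1) (tau A2) (tau B)
            & 0 < LRcoef (tau A1) (tau B2) (tau C)]]].

Definition sum_on (n : nat) (I : {set 'I_n}) (s : n.-tuple nat) : int :=
  (\sum_(i in I) (tnth s i)%:Z)%R.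

Definition single_row (n : nat) (s : n.-tuple nat) : Prop :=
  exists p, s = p :: nseq n.-1 0 :> seq nat.

Definition single_column (n : nat) (s : n.-tuple nat) : Prop :=
  exists2 k, k <= n & s = nseq k 1 ++ nseq (n - k) 0 :> seq nat.

(* Main.v *)
Require Import Defs.
From mathcomp Require Import all_boot all_order all_algebra.
From mathcomp Require Import zify.

(* If [la] is a row (column), then [N_(mu, nu, la) > 0] if and only if there is
   a partition [al] of size [(|mu| + |nu| - |la|) / 2] such that [mu / al] and
   [nu / al] are horizontal (vertical) strips.  Such [al] are the partitions
   between two explicit bounds [lo] and [hi], so one exists as soon as
   [lo <= hi] and the required size lies between [|lo|] and [|hi|].  Each of
   these conditions is the inequality of an explicit element of [G_n], all of
   whose Littlewood-Richardson coefficients are instances of the Pieri rule.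
   Since the hypotheses are invariant under cyclic shifts of [mu, nu, la], one
   may take the row or column to be [la]. *)

Set Implicit Arguments.
Unset Strict Implicit.
Unset Printing Implicit Defensive.

Local Notation "s `_ i" := (nth 0 s i) : nat_scope.

(** * Sums of parts and counts of cells *)

Lemma is_partP (s : seq nat) :
  reflect (forall i, s`_i.+1 <= s`_i) (is_part s).
Proof.
apply: (iffP idP) => [s_part i|s_dec]; first exact: is_part_nth.
by apply/(sortedP 0) => i _; apply: s_dec.
Qed.

Lemma nth_leq_sumn (s : seq nat) (i : nat) : s`_i <= sumn s.
Proof.
elim: s i => [|x s IH] [|i] //=; first exact: leq_addr.
exact: leq_trans (IH i) (leq_addl _ _).
Qed.

Lemma sum_ord_recr (f : nat -> nat) (m : nat) :
  \sum_(i < m.+1) f i = \sum_(i < m) f i + f m.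
Proof. exact: big_ord_recr. Qed.

Lemma leq_sum_widen (f : nat -> nat) (m n : nat) :
  m <= n -> \sum_(i < m) f i <= \sum_(i < n) f i.
Proof.
move=> le_mn; rewrite -!(big_mkord xpredT f) [leqRHS](big_cat_nat (n := m)) //.
exact: leq_addr.
Qed.

Lemma leq_sum_bool (b : nat -> bool) (m : nat) : \sum_(i < m) b i <= m.
Proof.
by rewrite -[leqRHS]card_ord -sum1_card leq_sum // => i _; apply: leq_b1.
Qed.

Lemma sum_iota (f : nat -> nat) (m : nat) :
  \sum_(i <- iota 0 m) f i = \sum_(i < m) f i.
Proof. by rewrite -(big_mkord xpredT) /index_iota subn0. Qed.

Lemma sumn_nth (s : seq nat) (m : nat) :
  (forall i, m <= i -> s`_i = 0) -> sumn s = \sum_(i < m) s`_i.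
Proof.
elim: s m => [|x s IH] [|m] s0; rewrite ?big_ord0 //.
- by rewrite big1 // => i _; rewrite nth_nil.
- have /= -> := s0 0 isT; rewrite (IH 0) ?big_ord0 // => i _.
  exact: (s0 i.+1).
by rewrite big_ord_recl /= (IH m) // => i; apply: (s0 i.+1).
Qed.

Lemma sum_nth_leq_sumn (s : seq nat) (m : nat) : \sum_(i < m) s`_i <= sumn s.
Proof.
rewrite (@sumn_nth s (maxn m (size s))) => [|i].
  exact/leq_sum_widen/leq_maxl.
by rewrite geq_max => /andP[_ /(nth_default 0)].
Qed.

Lemma sumn_nth_sub (s t : seq nat) (m : nat) :
  (forall i, s`_i <= t`_i) -> size t <= m -> sumn s = \sum_(i < m) s`_i.
Proof.
move=> le_st le_tm; apply: sumn_nth => i /(leq_trans le_tm)/(nth_default 0) t0.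
by have := le_st i; rewrite t0 leqn0 => /eqP.
Qed.

Lemma leq_sumn_sub (s t : seq nat) :
  (forall i, s`_i <= t`_i) -> sumn s <= sumn t.
Proof.
move=> le_st; rewrite (sumn_nth_sub le_st (leqnn _)).
by rewrite (@sumn_nth_sub t t (size t)) // leq_sum.
Qed.

Lemma nth_eq_sumn (s t : seq nat) :
  (forall i, s`_i <= t`_i) -> sumn s = sumn t -> nth 0 s =1 nth 0 t.
Proof.
move=> le_st eq_sum i; pose m := maxn i.+1 (maxn (size s) (size t)).
have sum_m r : size r <= m -> sumn r = \sum_(j < m) r`_j.
  move=> le_rm; apply: sumn_nth => j le_mj.
  exact/nth_default/(leq_trans le_rm).
have lt_im : i < m by rewrite leq_maxl.
have [_] := leqif_sum (fun (j : 'I_m) (_ : true) => leqif_eq (le_st j)).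
rewrite -!sum_m ?leq_max ?leqnn ?orbT // eq_sum eqxx.
by move/esym/forallP/(_ (Ordinal lt_im))/eqP.
Qed.

Lemma card_ord_between (h a b : nat) : b <= h ->
  #|[set j : 'I_h | a <= j < b]| = b - a.
Proof.
move=> le_bh; rewrite cardsE -sum1_card.
rewrite -[b - a](muln1) -sum_nat_const_nat (big_nat_widen _ _ _ _ _ le_bh).
by rewrite big_geq_mkord; apply: eq_bigl => j; rewrite unfold_in andbC.
Qed.

Lemma card_cells_between (r h m : nat) (f g : nat -> nat) : m <= r ->
  (forall i, f i <= g i <= h) ->
  #|[set c : 'I_r * 'I_h | (c.1 < m) && (f c.1 <= c.2 < g c.1)]|
    + \sum_(i < m) f i = \sum_(i < m) g i.
Proof.
move=> le_mr f_g_h; rewrite cardsE -sum1_card.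
pose between (i j : nat) := f i <= j < g i.
rewrite (eq_bigl (fun c : 'I_r * 'I_h => (c.1 < m) && between c.1 c.2)) //.
rewrite -(pair_big_dep (fun i : 'I_r => i < m)
  (fun i (j : 'I_h) => between i j) (fun _ _ => 1)) /=.
under eq_bigr => i _.
  have /andP[_ /(card_ord_between (f i)) card_i] := f_g_h i.
  rewrite sum1dep_card card_i; over.
rewrite (big_ord_narrow le_mr (F := fun i : 'I_r => g i - f i)) -big_split.
by apply: eq_bigr => i _ /=; rewrite subnK //; have /andP[] := f_g_h i.
Qed.

Lemma find_iota_leq (p : pred nat) (n k : nat) :
  (forall i j, i <= j -> p i -> p j) -> p n -> k <= n ->
  (find p (iota 0 n.+1) <= k) = p k.
Proof.
move=> p_mono pn le_kn; have has_p : has p (iota 0 n.+1).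
  by apply/hasP; exists n; rewrite // mem_iota ltnS leqnn.
have := has_p; rewrite has_find size_iota => lt_find.
have := nth_find 0 has_p; rewrite nth_iota // add0n => p_find.
apply/idP/idP => [/p_mono -> //|pk]; rewrite leqNgt; apply/negP => lt_k.
by have := before_find 0 lt_k; rewrite nth_iota ?add0n ?pk.
Qed.

(** * Littlewood-Richardson patterns *)

Definition horizontal_strip (f g : nat -> nat) : Prop :=
  forall i, g i.+1 <= f i <= g i.

Definition vertical_strip (f g : nat -> nat) : Prop :=
  forall i, f i <= g i <= (f i).+1.

Lemma horizontal_strip_leq (f g : nat -> nat) (i : nat) :
  horizontal_strip f g -> f i <= g i.
Proof. by move=> /(_ i)/andP[]. Qed.

Lemma vertical_strip_leq (f g : nat -> nat) (i : nat) :
  vertical_strip f g -> f i <= g i.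
Proof. by move=> /(_ i)/andP[]. Qed.

(* [P k i] stands for the number of cells of row [i] that lie in [al] or have an
   entry at most [k].  In the ballot condition, the entries [k + 2] of the first
   [m + 1] rows are compared with the entries [k + 1] of the first [m] rows, the
   subtractions being moved to the other side. *)
Record LR_pattern (al be ga : seq nat) (P : nat -> nat -> nat) : Prop :=
  LRPattern {
    pattern_inner : P 0 =1 nth 0 al;
    pattern_outer : P (size be) =1 nth 0 ga;
    pattern_strip k : horizontal_strip (P k) (P k.+1);
    pattern_content k : k < size be ->
      \sum_(i < size ga) P k.+1 i = \sum_(i < size ga) P k i + be`_k;
    pattern_ballot m k :
      \sum_(i < m.+1) P k.+2 i + \sum_(i < m) P k i
        <= \sum_(i < m.+1) P k.+1 i + \sum_(i < m) P k.+1 i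
  }.

Section TableauOfPattern.

Variables (al be ga : seq nat) (P : nat -> nat -> nat).
Hypotheses (ga_part : is_part ga) (patP : LR_pattern al be ga P).

Lemma pattern_mono i k l : k <= l -> P k i <= P l i.
Proof.
elim: l => [|l IH]; first by rewrite leqn0 => /eqP ->.
rewrite leq_eqVlt => /predU1P[-> //|/IH le_k].
by have /andP[_] := pattern_strip patP l i; apply: leq_trans.
Qed.

Lemma pattern_interlace i i' k : i < i' -> P k.+1 i' <= P k i.
Proof.
elim: i' => // i' IH; have /andP[lt_row _] := pattern_strip patP k i'.
rewrite ltnS leq_eqVlt => /predU1P[-> //|/IH]; apply: leq_trans.
exact: leq_trans lt_row (pattern_mono _ (leqnSn _)).
Qed.

Lemma pattern_leq_head k i : k <= size be -> P k i <= head 0 ga.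
Proof.
move/(pattern_mono i)/leq_trans; apply; rewrite (pattern_outer patP) -nth0.
exact: is_part_nth.
Qed.

Definition pattern_entry (i j : nat) : nat :=
  if j < ga`_i then find (fun k => j < P k i) (iota 0 (size be).+1) else 0.

Lemma pattern_entry_leq i j k : k <= size be -> j < ga`_i ->
  (pattern_entry i j <= k) = (j < P k i).
Proof.
move=> le_k lt_j; rewrite /pattern_entry lt_j find_iota_leq //.
  by move=> k1 k2 le_k12 /leq_trans; apply; apply: pattern_mono.
by rewrite (pattern_outer patP).
Qed.

Lemma pattern_entry_out i j : ga`_i <= j -> pattern_entry i j = 0.
Proof. by rewrite /pattern_entry ltnNge => ->. Qed.

Lemma pattern_entry_leq_size i j : pattern_entry i j <= size be.
Proof.
case: (ltnP j ga`_i) => [lt_j|/pattern_entry_out-> //].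
by rewrite pattern_entry_leq // (pattern_outer patP).
Qed.

Lemma pattern_entry_gt0 i j : (0 < pattern_entry i j) = (al`_i <= j < ga`_i).
Proof.
case: (ltnP j ga`_i) => [lt_j|/pattern_entry_out->]; last by rewrite andbF.
rewrite [0 < _]ltnNge pattern_entry_leq // (pattern_inner patP).
by rewrite -leqNgt andbT.
Qed.

Lemma pattern_entry_eqS i j k : k < size be ->
  (pattern_entry i j == k.+1) = (P k i <= j < P k.+1 i).
Proof.
move=> lt_k; case: (ltnP j ga`_i) => [lt_j|le_j].
  rewrite eqn_leq pattern_entry_leq // [k < _]ltnNge.
  by rewrite pattern_entry_leq ?(ltnW lt_k) // -leqNgt andbC.
rewrite pattern_entry_out //; apply/esym/negbTE; rewrite negb_and orbC -leqNgt.
by rewrite (leq_trans (pattern_mono _ lt_k)) // (pattern_outer patP).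
Qed.

Let cell : finType := ('I_(size ga) * 'I_(head 0 ga))%type.

Definition pattern_tableau : {ffun cell -> 'I_(size be).+1} :=
  [ffun c : cell => inord (pattern_entry c.1 c.2)].

Lemma pattern_tableauE c : pattern_tableau c = pattern_entry c.1 c.2 :> nat.
Proof. by rewrite ffunE inordK // ltnS pattern_entry_leq_size. Qed.

Lemma card_pattern_tableau m k : k < size be -> m <= size ga ->
  #|[set c : cell | (c.1 < m) && (pattern_tableau c == k.+1 :> nat)]|
    + \sum_(i < m) P k i = \sum_(i < m) P k.+1 i.
Proof.
move=> lt_k le_m.
rewrite -(@card_cells_between (size ga) (head 0 ga) m (P k) (P k.+1)) //.
  congr (_ + _); apply: eq_card => c.
  by rewrite !inE pattern_tableauE pattern_entry_eqS.
by move=> i; rewrite pattern_mono ?pattern_leq_head.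
Qed.

Lemma pattern_tableau_skew_filling : skew_filling al pattern_tableau.
Proof. by apply/forallP => c; rewrite pattern_tableauE pattern_entry_gt0. Qed.

Lemma pattern_tableau_row_weak : row_weak pattern_tableau.
Proof.
apply/forallP => -[i j]; apply/forallP => -[i' j']; apply/implyP.
rewrite !pattern_tableauE /= => /and4P[/eqP <- le_j _].
rewrite pattern_entry_gt0 => /andP[_ lt_j'].
rewrite pattern_entry_leq ?pattern_entry_leq_size ?(leq_ltn_trans le_j) //.
by rewrite -pattern_entry_leq ?pattern_entry_leq_size.
Qed.

Lemma pattern_tableau_col_strict : col_strict pattern_tableau.
Proof.
apply/forallP => -[i j]; apply/forallP => -[i' j']; apply/implyP.
rewrite !pattern_tableauE /= => /and4P[/eqP <- lt_i].
rewrite pattern_entry_gt0 => /andP[_ lt_j].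
case entryE: (pattern_entry i' j) => [//|k] _.
have lt_k : k < size be by rewrite -entryE pattern_entry_leq_size.
have: pattern_entry i' j == k.+1 by rewrite entryE.
rewrite pattern_entry_eqS // => /andP[_ lt_jP].
rewrite ltnS pattern_entry_leq ?(ltnW lt_k) //.
exact: leq_trans lt_jP (pattern_interlace _ lt_i).
Qed.

Lemma pattern_tableau_has_content : has_content pattern_tableau.
Proof.
apply/forallP => k; rewrite -(eqn_add2r (\sum_(i < size ga) P k i)).
rewrite [X in _ == X]addnC -(pattern_content patP) //.
rewrite -(card_pattern_tableau (ltn_ord k) (leqnn _)) eqn_add2r.
by apply/eqP/eq_card => c; rewrite !inE ltn_ord.
Qed.

Lemma pattern_tableau_ballot : ballot pattern_tableau.
Proof.
apply/forallP => -[i j]; apply/forallP => -[[|k] lt_k] //=.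
pose first_rows m v :=
  [set c : cell | (c.1 < m) && (pattern_tableau c == v :> nat)].
apply: (@leq_trans #|first_rows i.+1 k.+2|).
  apply/subset_leq_card/subsetP => d; rewrite !inE ltnS => /andP[before ->].
  by case/orP: before => [/ltnW ->//|/andP[/eqP -> _]]; rewrite leqnn.
apply: (@leq_trans #|first_rows i k.+1|); last first.
  apply/subset_leq_card/subsetP => d; rewrite !inE /read_before /=.
  by move=> /andP[-> ->].
have := card_pattern_tableau lt_k (ltn_ord i).
have := card_pattern_tableau (ltnW lt_k) (ltnW (ltn_ord i)).
by rewrite -!/(first_rows _ _); have := pattern_ballot patP i k; lia.
Qed.

Lemma LRcoef_pattern_gt0 : 0 < LRcoef al be ga.
Proof.
rewrite /LRcoef ifT; last first.
  apply/part_subP => i; rewrite -(pattern_inner patP) -(pattern_outer patP).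
  exact: pattern_mono.
apply/card_gt0P; exists pattern_tableau; rewrite inE; apply/and5P; split.
- exact: pattern_tableau_skew_filling.
- exact: pattern_tableau_row_weak.
- exact: pattern_tableau_col_strict.
- exact: pattern_tableau_has_content.
- exact: pattern_tableau_ballot.
Qed.

End TableauOfPattern.

(** * The Pieri rules *)

Definition is_row (s : seq nat) : Prop := forall i, s`_i.+1 = 0.

Definition is_column (s : seq nat) : Prop := forall i, s`_i = (i < sumn s).

Lemma sumn_row (s : seq nat) : is_row s -> sumn s = s`_0.
Proof. by move=> s_row; rewrite (@sumn_nth s 1) ?big_ord1 // => -[]. Qed.

Lemma leq_sumn_size_column (s : seq nat) : is_column s -> sumn s <= size s.
Proof.
by move=> s_col; have := s_col (size s); rewrite nth_default //; case: ltnP.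
Qed.

Lemma is_part_row (s : seq nat) : is_row s -> is_part s.
Proof. by move=> s_row; apply/is_partP => i; rewrite s_row. Qed.

Lemma is_part_column (s : seq nat) : is_column s -> is_part s.
Proof. by move=> s_col; apply/is_partP => i; rewrite !s_col; lia. Qed.

Lemma horizontal_strip_refl (s : seq nat) :
  is_part s -> horizontal_strip (nth 0 s) (nth 0 s).
Proof. by move/is_partP=> s_dec i; rewrite s_dec leqnn. Qed.

Lemma LRcoef_row_right_gt0 (al be ga : seq nat) :
  is_part ga -> is_row be -> horizontal_strip (nth 0 al) (nth 0 ga) ->
  sumn al + sumn be = sumn ga -> 0 < LRcoef al be ga.
Proof.
move=> ga_part be_row al_ga sumE.
have le_al i : al`_i <= ga`_i := horizontal_strip_leq i al_ga.
pose P k := if k is 0 then nth 0 al else nth 0 ga.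
apply: (LRcoef_pattern_gt0 (P := P)) => //; split=> //.
- case: be {be_row} sumE => // /=; rewrite addn0 => sumE.
  exact: nth_eq_sumn.
- by case=> [|k] //; exact: (horizontal_strip_refl ga_part).
- case=> [|k] _ /=; last by rewrite be_row addn0.
  by rewrite -(sumn_row be_row) -(sumn_nth_sub le_al) -?(@sumn_nth_sub ga ga).
- by move=> m [|k] //=; rewrite leq_add2l leq_sum.
Qed.

Lemma downward_ind (n : nat) (Q : nat -> Prop) :
  (forall k, n <= k -> Q k) -> (forall k, Q k.+1 -> Q k) -> forall k, Q k.
Proof.
move=> Qn Qpred k; have: n <= k + n by apply: leq_addl.
elim: {2}n k => [|d IH] k; first by rewrite addn0 => /Qn.
by rewrite -addSnnS => /IH/Qpred.
Qed.

Section SkewTail.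

Variables be ga : seq nat.
Hypotheses (ga_part : is_part ga) (be_ga : forall i, be`_i <= ga`_i).

Definition skew_tail (k : nat) : nat :=
  \sum_(k <= j < size ga) (ga`_j - be`_j).

Lemma skew_tail_eq0 k : ga`_k = 0 -> skew_tail k = 0.
Proof.
move=> gak0; rewrite /skew_tail big_nat big1 // => j /andP[le_kj _].
apply/eqP; rewrite subn_eq0.
by have := is_part_nth ga_part le_kj; rewrite gak0 leqn0 => /eqP ->.
Qed.

Lemma skew_tailS k : be`_k + skew_tail k = ga`_k + skew_tail k.+1.
Proof.
case: (ltnP k (size ga)) => [lt_k|le_k].
  by rewrite /skew_tail big_ltn // addnA subnKC.
have gak0 := nth_default 0 le_k; have := be_ga k; rewrite gak0 leqn0 => /eqP ->.
by rewrite !skew_tail_eq0 // nth_default // ltnW.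
Qed.

Lemma skew_tail0 : sumn be + skew_tail 0 = sumn ga.
Proof.
rewrite (sumn_nth_sub be_ga (leqnn _)) (@sumn_nth_sub ga ga _ _ (leqnn _)) //.
rewrite /skew_tail big_mkord.
by rewrite -big_split; apply: eq_bigr => i _; apply: subnKC.
Qed.

Lemma skew_tail_leq_horizontal k :
  horizontal_strip (nth 0 be) (nth 0 ga) -> skew_tail k <= ga`_k.
Proof.
move=> be_ga_strip; elim/(@downward_ind (size ga)): k => [k le_k|k IH].
  by rewrite skew_tail_eq0 ?nth_default.
by have /andP[] := be_ga_strip k; have := skew_tailS k; lia.
Qed.

Lemma skew_tail_pos_vertical i k : vertical_strip (nth 0 be) (nth 0 ga) ->
  k <= i < k + skew_tail k -> 0 < ga`_i.
Proof.
move=> be_ga_strip; elim/(@downward_ind (size ga)): k => [k le_k|k IH].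
  by rewrite (skew_tail_eq0 (nth_default 0 le_k)) addn0; case: ltngtP.
case: (posnP ga`_k) => [/skew_tail_eq0->|gak_gt0].
  by rewrite addn0; case: ltngtP.
rewrite leq_eqVlt; case: eqP => [<- //|_ /= /andP[lt_ki lt_i]].
apply: IH; rewrite lt_ki /=; have := skew_tailS k; have := be_ga_strip k; lia.
Qed.

Lemma skew_tail_column i k : vertical_strip (nth 0 be) (nth 0 ga) ->
  size be <= k -> k <= i -> (i < k + skew_tail k) = ga`_i :> nat.
Proof.
move=> be_ga_strip.
elim/(@downward_ind (size ga)): k => [k le_k|k IH] le_be le_ki.
  have ga0 j : k <= j -> ga`_j = 0 by move/(leq_trans le_k)/(nth_default 0).
  by rewrite skew_tail_eq0 ga0 // addn0 ltnNge le_ki.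
have := skew_tailS k; have := be_ga_strip k; rewrite (nth_default 0 le_be).
have := is_part_nth ga_part le_ki.
case: (posnP ga`_k) => [gak0|gak_gt0] le_ga le_gak tailS.
  rewrite skew_tail_eq0 // addn0 ltnNge le_ki /=; lia.
move: le_ki; rewrite leq_eqVlt => /predU1P[<-|lt_ki]; first by lia.
by rewrite -IH ?(leq_trans le_be) //; lia.
Qed.

End SkewTail.

Definition splice (k : nat) (f g : nat -> nat) (i : nat) : nat :=
  if i < k then f i else g i.

Lemma sum_splice_low (f g : nat -> nat) (m k : nat) : m <= k ->
  \sum_(i < m) splice k f g i = \sum_(i < m) f i.
Proof.
move=> le_mk; apply: eq_bigr => i _.
by rewrite /splice (leq_trans (ltn_ord i) le_mk).
Qed.

Lemma sum_splice_high (f g : nat -> nat) (m k : nat) : k <= m ->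
  \sum_(i < m) splice k f g i = \sum_(i < k) f i + \sum_(k <= i < m) g i.
Proof.
move=> le_km; rewrite -(big_mkord xpredT (splice k f g)).
rewrite (big_cat_nat (n := k)) //= big_mkord sum_splice_low //; congr (_ + _).
by apply: eq_big_nat => i /andP[le_ki _]; rewrite /splice ltnNge le_ki.
Qed.

Section LRcoefRowLeft.

Variables be ga : seq nat.

Let tail := skew_tail be ga.

(* Row [i] of the tableau contains [tail i] entries [i], or cells of the inner
   shape if [i = 0], followed by entries [i + 1]. *)
Definition row_left_pattern (k : nat) : nat -> nat :=
  splice k (nth 0 ga) (fun i => if i == k then tail k else 0).

Lemma sum_row_left_pattern_low m k : m <= k ->
  \sum_(i < m) row_left_pattern k i = \sum_(i < m) ga`_i.
Proof. exact: sum_splice_low. Qed.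

Lemma sum_row_left_pattern_high m k : k < m ->
  \sum_(i < m) row_left_pattern k i = \sum_(i < k) ga`_i + tail k.
Proof.
move=> lt_km; rewrite sum_splice_high 1?ltnW //; congr (_ + _).
rewrite big_ltn // eqxx big_nat big1 ?addn0 // => i /andP[lt_ki _].
by case: eqP lt_ki => // ->; rewrite ltnn.
Qed.

Hypothesis ga_part : is_part ga.
Hypothesis be_ga_strip : horizontal_strip (nth 0 be) (nth 0 ga).

Let be_ga i : be`_i <= ga`_i.
Proof. exact: horizontal_strip_leq. Qed.

Let tailS k : be`_k + tail k = ga`_k + tail k.+1.
Proof. exact: skew_tailS. Qed.

Lemma row_left_pattern_strip k :
  horizontal_strip (row_left_pattern k) (row_left_pattern k.+1).
Proof.
move=> i; rewrite /row_left_pattern /splice ltnS eqSS.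
have := is_part_nth ga_part (leqnSn i); have := tailS k.
have := skew_tail_leq_horizontal ga_part be_ga k.+1 be_ga_strip.
have := be_ga_strip k; case: (ltngtP i k) => [lt_ik|lt_ki|->] //.
- by rewrite (leqW lt_ik) leqnn => _ _ _ ->.
- by rewrite ltnSn -/tail; lia.
Qed.

Lemma row_left_pattern_outer : row_left_pattern (size be) =1 nth 0 ga.
Proof.
move=> i; rewrite /row_left_pattern /splice; have := tailS (size be).
have := be_ga_strip (size be); rewrite (nth_default 0 (leqnn (size be))) leqn0.
move=> /andP[/eqP ga_succ0 _]; rewrite {2}/tail skew_tail_eq0 // addn0 => tailE.
case: ltngtP => [//|lt_i|-> //].
by have := is_part_nth ga_part lt_i; rewrite ga_succ0 leqn0 => /eqP.
Qed.

Lemma row_left_pattern_content k :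
  \sum_(i < size ga) row_left_pattern k.+1 i
    = \sum_(i < size ga) row_left_pattern k i + be`_k.
Proof.
case: (ltnP k (size ga)) => [lt_k|le_k]; last first.
  have := be_ga k; rewrite (nth_default 0 le_k) leqn0 => /eqP ->.
  by rewrite !sum_row_left_pattern_low ?addn0 // leqW.
rewrite (sum_row_left_pattern_high lt_k) -addnA [tail k + _]addnC tailS addnA.
rewrite -sum_ord_recr; move: lt_k; rewrite leq_eqVlt => /predU1P[eq_k|].
  rewrite sum_row_left_pattern_low eq_k // /tail skew_tail_eq0 ?addn0 //.
  by rewrite nth_default.
exact: sum_row_left_pattern_high.
Qed.

Lemma row_left_pattern_ballot m k :
  \sum_(i < m.+1) row_left_pattern k.+2 i + \sum_(i < m) row_left_pattern k i
    <= \sum_(i < m.+1) row_left_pattern k.+1 i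
       + \sum_(i < m) row_left_pattern k.+1 i.
Proof.
have := sum_ord_recr (nth 0 ga) k; have := sum_ord_recr (nth 0 ga) k.+1.
have := tailS k; have := tailS k.+1.
have := be_ga_strip k; have := be_ga k.+1.
case: (ltngtP m k.+1) => [lt_m|lt_m|->].
- by rewrite !sum_row_left_pattern_low ?(ltnW lt_m) // ltnW.
- by rewrite !sum_row_left_pattern_high //; lia.
rewrite !(sum_row_left_pattern_high (ltnSn _)) !sum_row_left_pattern_low //.
by lia.
Qed.

Lemma row_left_pattern_LR al : is_row al -> sumn al + sumn be = sumn ga ->
  LR_pattern al be ga row_left_pattern.
Proof.
move=> al_row sumE; split.
- case=> [|i]; rewrite /row_left_pattern /splice /= ?al_row //.
  rewrite -(sumn_row al_row).
  by apply/eqP; rewrite -(eqn_add2l (sumn be)) skew_tail0 // addnC sumE.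
- exact: row_left_pattern_outer.
- exact: row_left_pattern_strip.
- by move=> k _; apply: row_left_pattern_content.
- exact: row_left_pattern_ballot.
Qed.

End LRcoefRowLeft.

Lemma LRcoef_row_left_gt0 (al be ga : seq nat) :
  is_part ga -> is_row al -> horizontal_strip (nth 0 be) (nth 0 ga) ->
  sumn al + sumn be = sumn ga -> 0 < LRcoef al be ga.
Proof.
move=> ga_part al_row be_ga sumE.
have patP := row_left_pattern_LR ga_part be_ga al_row sumE.
exact: LRcoef_pattern_gt0 patP.
Qed.

Section LRcoefColumnRight.

Variables al ga : seq nat.
Hypothesis al_ga_strip : vertical_strip (nth 0 al) (nth 0 ga).

Let al_ga i : al`_i <= ga`_i.
Proof. exact: vertical_strip_leq. Qed.

Definition skew_head (m : nat) : nat := \sum_(i < m) (ga`_i - al`_i).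

Lemma skew_headS m : al`_m + skew_head m.+1 = ga`_m + skew_head m.
Proof.
by rewrite /skew_head big_ord_recr /= [_ + (_ - _)]addnC addnA subnKC.
Qed.

Lemma sum_skew_head m : \sum_(i < m) al`_i + skew_head m = \sum_(i < m) ga`_i.
Proof. by rewrite -big_split; apply: eq_bigr => i _; apply: subnKC. Qed.

Lemma skew_head_size : sumn al + skew_head (size ga) = sumn ga.
Proof.
rewrite (sumn_nth_sub al_ga (leqnn _)) sum_skew_head.
by rewrite -(@sumn_nth_sub ga ga).
Qed.

Lemma skew_head_leq m : sumn al + skew_head m <= sumn ga.
Proof.
pose M := maxn m (size ga); have le_M : size ga <= M by apply: leq_maxr.
rewrite (sumn_nth_sub al_ga le_M) (@sumn_nth_sub ga ga _ _ le_M) //.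
rewrite -sum_skew_head leq_add2l.
exact: (leq_sum_widen (fun i => ga`_i - al`_i) (leq_maxl m _)).
Qed.

(* The entries [1], [2], ... are placed one by one from top to bottom. *)
Definition column_right_pattern (k i : nat) : nat :=
  if skew_head i.+1 <= k then ga`_i else al`_i.

Lemma sum_column_right_pattern m k :
  \sum_(i < m) column_right_pattern k i
    = \sum_(i < m) al`_i + minn k (skew_head m).
Proof.
elim: m => [|m IH]; first by rewrite /skew_head !big_ord0 minn0.
rewrite !sum_ord_recr IH /column_right_pattern.
by have := skew_headS m; have := al_ga_strip m; case: ifP; lia.
Qed.

Hypotheses (al_part : is_part al) (ga_part : is_part ga).

Lemma column_right_pattern_strip k :
  horizontal_strip (column_right_pattern k) (column_right_pattern k.+1).
Proof.
move=> i; rewrite /column_right_pattern.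
have := skew_headS i.+1; have := al_ga i; have := al_ga_strip i.+1.
have := is_part_nth ga_part (leqnSn i); have := is_part_nth al_part (leqnSn i).
by do 3!case: ifP; lia.
Qed.

Lemma column_right_pattern_LR be :
  is_column be -> sumn al + sumn be = sumn ga ->
  LR_pattern al be ga column_right_pattern.
Proof.
move=> be_col sumE; have sum_be m : skew_head m <= sumn be.
  by rewrite -(leq_add2l (sumn al)) sumE skew_head_leq.
split.
- move=> i; rewrite /column_right_pattern leqn0; case: eqP => // head0.
  by have := skew_headS i; have := al_ga i; rewrite head0; lia.
- move=> i; rewrite /column_right_pattern (leq_trans (sum_be _)) //.
  exact: leq_sumn_size_column.
- exact: column_right_pattern_strip.
- move=> k _; rewrite !sum_column_right_pattern be_col.
  by have := skew_head_size; lia.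
- move=> m k; rewrite !sum_column_right_pattern.
  by have := skew_headS m; have := al_ga_strip m; lia.
Qed.

End LRcoefColumnRight.

Lemma LRcoef_column_right_gt0 (al be ga : seq nat) :
  is_part al -> is_part ga -> is_column be ->
  vertical_strip (nth 0 al) (nth 0 ga) ->
  sumn al + sumn be = sumn ga -> 0 < LRcoef al be ga.
Proof.
move=> al_part ga_part be_col al_ga sumE.
have patP := column_right_pattern_LR al_ga al_part ga_part be_col sumE.
exact: LRcoef_pattern_gt0 patP.
Qed.

Section LRcoefColumnLeft.

Variables be ga : seq nat.

Let tail := skew_tail be ga.

(* Row [i] of the tableau contains [i + 1] in all columns but the first; below
   the inner shape, the first column lists the [k + 1] such that row [k] of [ga]
   is not longer than row [k] of [be]. *)
Definition column_left_pattern (k : nat) : nat -> nat :=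
  splice k (nth 0 ga) (fun i => i < k + tail k).

Lemma sum_column_left_pattern_low m k : m <= k ->
  \sum_(i < m) column_left_pattern k i = \sum_(i < m) ga`_i.
Proof. exact: sum_splice_low. Qed.

Lemma sum_column_left_pattern_high m k : k <= m ->
  \sum_(i < m) column_left_pattern k i
    = \sum_(i < k) ga`_i + minn (m - k) (tail k).
Proof.
move=> le_km; rewrite sum_splice_high //; congr (_ + _).
elim: m le_km => [|m IH].
  by rewrite leqn0 => /eqP ->; rewrite big_geq ?min0n.
rewrite leq_eqVlt => /predU1P[->|lt_km].
  by rewrite big_geq ?subnn ?min0n.
by rewrite big_nat_recr //= IH //; lia.
Qed.

Hypothesis ga_part : is_part ga.
Hypothesis be_ga_strip : vertical_strip (nth 0 be) (nth 0 ga).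

Let be_ga i : be`_i <= ga`_i.
Proof. exact: vertical_strip_leq. Qed.

Let tailS k : be`_k + tail k = ga`_k + tail k.+1.
Proof. exact: skew_tailS. Qed.

Lemma column_left_pattern_outer : column_left_pattern (size be) =1 nth 0 ga.
Proof.
move=> i; rewrite /column_left_pattern /splice; case: ltnP => // le_i.
exact: skew_tail_column.
Qed.

Lemma column_left_pattern_strip k :
  horizontal_strip (column_left_pattern k) (column_left_pattern k.+1).
Proof.
move=> i; rewrite /column_left_pattern /splice ltnS.
have := is_part_nth ga_part (leqnSn i); have := tailS k; have := be_ga_strip k.
have := @skew_tail_pos_vertical _ _ ga_part be_ga i k be_ga_strip.
case: (ltngtP i k) => [lt_ik|lt_ki|->]; rewrite -/tail /=.
- by rewrite (leqW lt_ik) leqnn => _ _ _ ->.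
- by rewrite [i < k.+1]ltnNge lt_ki /=; lia.
- by rewrite ltnSn; lia.
Qed.

Lemma column_left_pattern_content k :
  \sum_(i < size ga) column_left_pattern k.+1 i
    = \sum_(i < size ga) column_left_pattern k i + be`_k.
Proof.
case: (ltnP k (size ga)) => [lt_k|le_k]; last first.
  have := be_ga k; rewrite (nth_default 0 le_k) leqn0 => /eqP ->.
  by rewrite !sum_column_left_pattern_low ?addn0 // leqW.
have tail_bound l : l <= size ga -> l + tail l <= size ga.
  move=> le_l; rewrite leqNgt; apply/negP => lt_size.
  have := @skew_tail_pos_vertical _ _ ga_part be_ga (size ga) l be_ga_strip.
  by rewrite le_l lt_size nth_default // => /(_ isT).
have := tail_bound _ (ltnW lt_k); have := tail_bound _ lt_k.
rewrite !sum_column_left_pattern_high ?(ltnW lt_k) // sum_ord_recr.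
by have := tailS k; lia.
Qed.

Hypothesis be_part : is_part be.

Lemma column_left_pattern_ballot m k :
  \sum_(i < m.+1) column_left_pattern k.+2 i
    + \sum_(i < m) column_left_pattern k i
    <= \sum_(i < m.+1) column_left_pattern k.+1 i
       + \sum_(i < m) column_left_pattern k.+1 i.
Proof.
case: (leqP m k) => [le_mk|lt_km].
  by have le_mk1 := leqW le_mk; rewrite !sum_column_left_pattern_low.
have le_km := ltnW lt_km.
rewrite !sum_column_left_pattern_high // !(sum_ord_recr (nth 0 ga)).
have := is_part_nth be_part (leqnSn k); have := is_part_nth ga_part (leqnSn k).
have := tailS k; have := tailS k.+1.
by have := be_ga_strip k; have := be_ga_strip k.+1; lia.
Qed.

Lemma column_left_pattern_LR al : is_column al -> sumn al + sumn be = sumn ga ->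
  LR_pattern al be ga column_left_pattern.
Proof.
move=> al_col sumE; split.
- move=> i; rewrite /column_left_pattern /splice /= add0n al_col.
  have : sumn be + tail 0 = sumn ga by apply: skew_tail0.
  by rewrite -sumE addnC => /addIn ->.
- exact: column_left_pattern_outer.
- exact: column_left_pattern_strip.
- by move=> k _; apply: column_left_pattern_content.
- exact: column_left_pattern_ballot.
Qed.

End LRcoefColumnLeft.

Lemma LRcoef_column_left_gt0 (al be ga : seq nat) :
  is_part be -> is_part ga -> is_column al ->
  vertical_strip (nth 0 be) (nth 0 ga) ->
  sumn al + sumn be = sumn ga -> 0 < LRcoef al be ga.
Proof.
move=> be_part ga_part al_col be_ga sumE.
have patP := column_left_pattern_LR ga_part be_ga be_part al_col sumE.
exact: LRcoef_pattern_gt0 patP.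
Qed.

(* The coefficients are symmetric in their lower arguments, but here it is
   easier to establish both positivities than that symmetry. *)
Definition LR_positive (al be ga : seq nat) : Prop :=
  0 < LRcoef al be ga /\ 0 < LRcoef be al ga.

Lemma LR_positiveC (al be ga : seq nat) :
  LR_positive al be ga -> LR_positive be al ga.
Proof. by case. Qed.

Lemma Pieri_row (al be ga : seq nat) :
  is_part ga -> is_row be -> horizontal_strip (nth 0 al) (nth 0 ga) ->
  sumn al + sumn be = sumn ga -> LR_positive al be ga.
Proof.
move=> ga_part be_row al_ga sumE; split; first exact: LRcoef_row_right_gt0.
by apply: LRcoef_row_left_gt0; rewrite // addnC.
Qed.

Lemma Pieri_column (al be ga : seq nat) :
  is_part al -> is_part ga -> is_column be ->
  vertical_strip (nth 0 al) (nth 0 ga) ->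
  sumn al + sumn be = sumn ga -> LR_positive al be ga.
Proof.
move=> al_part ga_part be_col al_ga sumE.
split; first exact: LRcoef_column_right_gt0.
by apply: LRcoef_column_left_gt0; rewrite // addnC.
Qed.

Lemma is_part_nseq (d x : nat) : is_part (nseq d x).
Proof. by apply/is_partP => i; rewrite !nth_nseq; do !case: ifP; lia. Qed.

Lemma is_row_nseq0 (d : nat) : is_row (nseq d 0).
Proof. by move=> i; rewrite nth_nseq if_same. Qed.

Lemma is_row_seq1 (x : nat) : is_row [:: x].
Proof. by move=> i; rewrite /= nth_nil. Qed.

Lemma is_column_nseq1 (d : nat) : is_column (nseq d 1).
Proof. by move=> i; rewrite sumn_nseq mul1n nth_nseq; case: ltnP. Qed.

Lemma LR_positive_nseq0 (d : nat) (al ga : seq nat) :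
  is_part ga -> nth 0 al =1 nth 0 ga -> LR_positive al (nseq d 0) ga.
Proof.
move=> ga_part al_ga; apply: Pieri_row => //; first exact: is_row_nseq0.
  by move=> i; rewrite al_ga; apply: horizontal_strip_refl.
rewrite sumn_nseq mul0n addn0 (@sumn_nth_sub ga ga (size ga)) //.
rewrite (@sumn_nth_sub al ga (size ga)) // => [|i]; last by rewrite al_ga.
by apply: eq_bigr => i _.
Qed.

Lemma LR_positive_nil (al : seq nat) : is_part al -> LR_positive al [::] al.
Proof. by move=> al_part; apply: (@LR_positive_nseq0 0). Qed.

Lemma LR_positive_zeros (x y z : nat) :
  LR_positive (nseq x 0) (nseq y 0) (nseq z 0).
Proof.
apply: LR_positive_nseq0; first exact: is_part_nseq.
by move=> i; rewrite !nth_nseq !if_same.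
Qed.

Lemma LR_positive_seq1 (x y : nat) : LR_positive [:: x] [:: y] [:: x + y].
Proof.
apply: Pieri_row; rewrite //= ?addn0 //; first exact: is_row_seq1.
by case=> [|i] /=; rewrite ?nth_nil ?leq_addr.
Qed.

Lemma LR_positive_ones (x y : nat) :
  LR_positive (nseq x 1) (nseq y 1) (nseq (x + y) 1).
Proof.
apply: Pieri_column; rewrite ?is_part_nseq ?sumn_nseq ?mul1n //.
  exact: is_column_nseq1.
by move=> i; rewrite !is_column_nseq1 !sumn_nseq !mul1n; lia.
Qed.

Lemma LR_positive_cons (x : nat) (s : seq nat) :
  is_part (x :: s) -> LR_positive s [:: x] (x :: s).
Proof.
move=> xs_part; apply: Pieri_row => //=; last by rewrite addn0 addnC.
  exact: is_row_seq1.
by move=> i; rewrite leqnn; have := is_part_nth xs_part (leqnSn i).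
Qed.

Lemma LR_positive_rcons0 (s : seq nat) :
  is_part s -> LR_positive s [:: 0] (rcons s 0).
Proof.
have nth_rcons0 i : (rcons s 0)`_i = s`_i.
  rewrite nth_rcons; case: ltngtP => // [lt_i|->]; last by rewrite nth_default.
  by rewrite nth_default // ltnW.
move=> /is_partP s_dec; apply: (@LR_positive_nseq0 1) => [|i].
  by apply/is_partP => i; rewrite !nth_rcons0.
by rewrite nth_rcons0.
Qed.

Lemma LR_positive_succn (s : seq nat) :
  is_part s -> LR_positive s (nseq (size s) 1) (map succn s).
Proof.
move=> s_part.
have succ_part : is_part (map succn s).
  by rewrite /is_part sorted_map.
apply: Pieri_column => //; first exact: is_column_nseq1.
  move=> i; case: (ltnP i (size s)) => [lt_i|le_i].
    by rewrite (nth_map 0) // leqnSn leqnn.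
  by rewrite !nth_default ?size_map.
by rewrite sumn_nseq mul1n; elim: s {s_part succ_part} => //= x s <-; lia.
Qed.

(** * Newell-Littlewood numbers *)

Lemma bounded_part_lift (m b : nat) (s : seq nat) :
  size s = m -> is_part s -> (forall i, s`_i <= b) ->
  exists2 t : m.-tuple 'I_b.+1, bounded_part t & map val t = s.
Proof.
move=> s_m s_part le_b.
have size_lift : size [seq inord x : 'I_b.+1 | x <- s] == m.
  by rewrite size_map s_m.
suff valE : map val (Tuple size_lift) = s.
  by exists (Tuple size_lift); rewrite // /bounded_part valE.
rewrite /= -map_comp -[RHS]map_id; apply/eq_in_map => x /(nthP 0)[i _ <-] /=.
by rewrite inordK // ltnS.
Qed.

Definition NL_witness (n : nat) (mu nu la : seq nat) : Prop :=
  exists al be ga : seq nat,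
    [/\ [/\ size al = n, size be = n & size ga = n],
        [/\ is_part al, is_part be & is_part ga]
      & [/\ LR_positive al be mu, LR_positive al ga nu
          & LR_positive be ga la]].

Lemma NL_witness_rot (n : nat) (mu nu la : seq nat) :
  NL_witness n mu nu la -> NL_witness n nu la mu.
Proof.
move=> [al [be [ga [sizes [al_part be_part ga_part] [LR_mu LR_nu LR_la]]]]].
have [al_n be_n ga_n] := sizes.
by exists ga, al, be; split; split=> //; apply: LR_positiveC.
Qed.

Lemma NL_witness_gt0 (n : nat) (mu nu la : n.-tuple nat) :
  is_part mu -> is_part nu -> NL_witness n mu nu la -> 0 < NL mu nu la.
Proof.
move=> mu_part nu_part [al [be [ga [[al_n be_n ga_n]]]]].
move=> [al_part be_part ga_part] [[LR_mu _] [LR_nu _] [LR_la _]].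
have /andP[/part_subP al_mu /part_subP be_mu] := LRcoef_gt0_sub mu_part LR_mu.
have /andP[_ /part_subP ga_nu] := LRcoef_gt0_sub nu_part LR_nu.
have lift (s t : seq nat) : size t = n -> size s = n -> is_part s ->
    (forall i, s`_i <= t`_i) ->
    exists2 u : (size t).-tuple 'I_(sumn t).+1, bounded_part u & map val u = s.
  move=> t_n s_n s_part s_t; apply: bounded_part_lift; rewrite ?t_n // => i.
  exact: leq_trans (s_t i) (nth_leq_sumn t i).
have [t_al t_al_part t_alE] := lift _ _ (size_tuple mu) al_n al_part al_mu.
have [t_be t_be_part t_beE] := lift _ _ (size_tuple mu) be_n be_part be_mu.
have [t_ga t_ga_part t_gaE] := lift _ _ (size_tuple nu) ga_n ga_part ga_nu.
rewrite /NL (bigD1 t_al) //= (bigD1 t_be) //= (bigD1 t_ga) //=.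
by rewrite t_alE t_beE t_gaE !addn_gt0 !muln_gt0 LR_mu LR_nu LR_la.
Qed.

(** * Elements of [G_n] as increasing lists *)

(* [tau I], read off the increasing list of the elements of [I : {set 'I_n}]. *)
Definition seq_tau (s : seq nat) : seq nat :=
  rev [seq s`_k - k | k <- iota 0 (size s)].

Definition increasing_below (n : nat) (s : seq nat) : bool :=
  sorted ltn s && all (gtn n) s.

Definition seq_set (n : nat) (s : seq nat) : {set 'I_n} :=
  [set i | val i \in s].

Lemma enum_seq_set (n : nat) (s : seq nat) : increasing_below n s ->
  map val (enum (seq_set n s)) = s.
Proof.
case/andP=> s_incr /allP lt_s; apply: (irr_sorted_eq ltn_trans ltnn) => //.
  rewrite sorted_map /enum_mem -enumT; apply: sorted_filter.
    by move=> j i k; apply: ltn_trans.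
  by rewrite -(@sorted_map _ _ val ltn) val_enum_ord iota_ltn_sorted.
move=> x; apply/mapP/idP => [[i]|x_s]; first by rewrite mem_enum inE => x_i ->.
by exists (Ordinal (lt_s _ x_s)); rewrite // mem_enum inE.
Qed.

Lemma tau_seq_set (n : nat) (s : seq nat) : increasing_below n s ->
  tau (seq_set n s) = seq_tau s.
Proof.
move=> s_incr; rewrite -[in RHS](enum_seq_set s_incr) /tau /seq_tau !size_map.
congr rev; apply/eq_in_map => k; rewrite mem_iota add0n /= => lt_k.
have i0 : 'I_n by case: (enum _) lt_k.
by rewrite !(nth_map i0) // subSS.
Qed.

Lemma card_seq_set (n : nat) (s : seq nat) : increasing_below n s ->
  #|seq_set n s| = size s.
Proof. by move=> s_incr; rewrite cardE -(size_map val) enum_seq_set. Qed.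

Lemma sum_on_seq_set (n : nat) (s : seq nat) (mu : n.-tuple nat) :
  increasing_below n s ->
  sum_on (seq_set n s) mu = (\sum_(x <- s) mu`_x)%N%:Z%R.
Proof.
move=> s_incr; rewrite -[in RHS](enum_seq_set s_incr) big_map big_enum /=.
rewrite -[RHS]intz -[RHS]/(_%:R)%R GRing.natr_sum; apply: eq_bigr => i _.
by rewrite (tnth_nth 0) natz.
Qed.

Lemma seq_set_disjoint (n : nat) (s t : seq nat) : ~~ has (mem s) t ->
  seq_set n s :&: seq_set n t = set0.
Proof.
move/hasPn => notin_s; apply/setP => i; rewrite !inE.
by apply/negbTE/negP => /andP[i_s /notin_s /=]; rewrite i_s.
Qed.

Definition tau_LR (s1 s2 s : seq nat) : Prop :=
  LR_positive (seq_tau s1) (seq_tau s2) (seq_tau s).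

Lemma tau_LRC (s1 s2 s : seq nat) : tau_LR s1 s2 s -> tau_LR s2 s1 s.
Proof. exact: LR_positiveC. Qed.

Definition equisized_tau_LR (s1 s2 s : seq nat) : Prop :=
  [/\ size s1 = size s, size s2 = size s & tau_LR s1 s2 s].

Lemma equisized_tau_LRC (s1 s2 s : seq nat) :
  equisized_tau_LR s1 s2 s -> equisized_tau_LR s2 s1 s.
Proof. by case=> size1 size2 /tau_LRC. Qed.

(* The elements of [G_n] whose coefficients remain positive when their lower
   arguments are exchanged, with increasing lists in place of sets. *)
Definition seq_in_G (n : nat) (a a' b b' c c' : seq nat) : Prop :=
  [/\ all (increasing_below n) [:: a; a'; b; b'; c; c'],
      [/\ ~~ has (mem a) a', ~~ has (mem b) b' & ~~ has (mem c) c'],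
      [/\ size a = size b' + size c', size b = size a' + size c'
        & size c = size a' + size b']
    & exists a1 a2 b1 b2 c1 c2 : seq nat,
      [/\ all (increasing_below n) [:: a1; a2; b1; b2; c1; c2],
          [/\ equisized_tau_LR a1 a2 a', equisized_tau_LR b1 b2 b'
            & equisized_tau_LR c1 c2 c']
        & [/\ tau_LR b1 c2 a, tau_LR c1 a2 b & tau_LR a1 b2 c]]].

Lemma seq_in_G_rot (n : nat) (a a' b b' c c' : seq nat) :
  seq_in_G n a a' b b' c c' -> seq_in_G n b b' c c' a a'.
Proof.
case=> /and5P[a_n a'_n b_n b'_n /and3P[c_n c'_n _]].
move=> [disj_a disj_b disj_c] [size_a size_b size_c].
case=> a1 [a2 [b1 [b2 [c1 [c2 []]]]]].
move=> /and5P[a1_n a2_n b1_n b2_n /and3P[c1_n c2_n _]].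
move=> [inner_a inner_b inner_c] [outer_a outer_b outer_c].
split=> //; first by rewrite /= b_n b'_n c_n c'_n a_n a'_n.
  by split; rewrite // addnC.
exists b1, b2, c1, c2, a1, a2; split=> //.
by rewrite /= b1_n b2_n c1_n c2_n a1_n a2_n.
Qed.

Lemma seq_in_G_swap (n : nat) (a a' b b' c c' : seq nat) :
  seq_in_G n a a' b b' c c' -> seq_in_G n b b' a a' c c'.
Proof.
case=> /and5P[a_n a'_n b_n b'_n /and3P[c_n c'_n _]].
move=> [disj_a disj_b disj_c] [size_a size_b size_c].
case=> a1 [a2 [b1 [b2 [c1 [c2 []]]]]].
move=> /and5P[a1_n a2_n b1_n b2_n /and3P[c1_n c2_n _]].
move=> [inner_a inner_b inner_c] [outer_a outer_b outer_c].
split=> //; first by rewrite /= b_n b'_n a_n a'_n c_n c'_n.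
  by split; rewrite // addnC.
exists b2, b1, a2, a1, c2, c1; split.
- by rewrite /= b2_n b1_n a2_n a1_n c2_n c1_n.
- by split; apply: equisized_tau_LRC.
- by split; apply: tau_LRC.
Qed.

Lemma in_G_seq_set (n : nat) (a a' b b' c c' : seq nat) :
  seq_in_G n a a' b b' c c' ->
  in_G (seq_set n a) (seq_set n a') (seq_set n b) (seq_set n b')
    (seq_set n c) (seq_set n c').
Proof.
case=> /and5P[a_n a'_n b_n b'_n /and3P[c_n c'_n _]].
move=> [disj_a disj_b disj_c] [size_a size_b size_c].
case=> a1 [a2 [b1 [b2 [c1 [c2 []]]]]].
move=> /and5P[a1_n a2_n b1_n b2_n /and3P[c1_n c2_n _]].
move=> [[size_a1 size_a2 [inner_a _]] [size_b1 size_b2 [inner_b _]]].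
move=> [size_c1 size_c2 [inner_c _]] [[outer_a _] [outer_b _] [outer_c _]].
split; [by split; apply: seq_set_disjoint | by rewrite !card_seq_set |].
exists (seq_set n a1), (seq_set n a2), (seq_set n b1), (seq_set n b2).
exists (seq_set n c1), (seq_set n c2).
by rewrite !card_seq_set // !tau_seq_set.
Qed.

Definition extended_Horn (n : nat) (mu nu la : n.-tuple nat) : Prop :=
  forall A A' B B' C C' : {set 'I_n}, in_G A A' B B' C C' ->
     (0 <= sum_on A mu - sum_on A' mu + sum_on B nu - sum_on B' nu
           + sum_on C la - sum_on C' la)%R.

Definition seq_Horn (n : nat) (mu nu la : seq nat) : Prop :=
  forall a a' b b' c c' : seq nat, seq_in_G n a a' b b' c c' ->
    \sum_(x <- a') mu`_x + \sum_(x <- b') nu`_x + \sum_(x <- c') la`_x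
      <= \sum_(x <- a) mu`_x + \sum_(x <- b) nu`_x + \sum_(x <- c) la`_x.

Lemma extended_Horn_seq (n : nat) (mu nu la : n.-tuple nat) :
  extended_Horn mu nu la -> seq_Horn n mu nu la.
Proof.
move=> horn a a' b b' c c' abcG; have := horn _ _ _ _ _ _ (in_G_seq_set abcG).
case: abcG => /and5P[a_n a'_n b_n b'_n /and3P[c_n c'_n _]] _ _ _.
by rewrite !sum_on_seq_set //; lia.
Qed.

Lemma seq_Horn_rot (n : nat) (mu nu la : seq nat) :
  seq_Horn n mu nu la -> seq_Horn n la mu nu.
Proof. by move=> horn a a' b b' c c' /seq_in_G_rot/horn; lia. Qed.

Lemma seq_Horn_swap (n : nat) (mu nu la : seq nat) :
  seq_Horn n mu nu la -> seq_Horn n nu mu la.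
Proof. by move=> horn a a' b b' c c' /seq_in_G_swap/horn; lia. Qed.

Lemma leq_nth_increasing (s : seq nat) (k : nat) :
  sorted ltn s -> k < size s -> k <= s`_k.
Proof.
move=> /(sortedP 0) s_incr; elim: k => // k IH lt_k.
exact: leq_ltn_trans (IH (ltnW lt_k)) (s_incr k lt_k).
Qed.

Lemma is_part_seq_tau (s : seq nat) : sorted ltn s -> is_part (seq_tau s).
Proof.
move=> s_incr; rewrite /is_part /seq_tau rev_sorted; apply/(sortedP 0) => k.
rewrite size_map size_iota => lt_k; have lt_k' := ltnW lt_k.
rewrite !(nth_map 0) ?size_iota // !nth_iota // !add0n /=.
by have /(sortedP 0)/(_ k lt_k) := s_incr; lia.
Qed.

Lemma size_seq_tau (s : seq nat) : size (seq_tau s) = size s.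
Proof. by rewrite size_rev size_map size_iota. Qed.

Lemma seq_tau_iota (x d : nat) : seq_tau (iota x d) = nseq d x.
Proof.
rewrite /seq_tau size_iota -[RHS](revK) rev_nseq; congr rev.
apply: (@eq_from_nth _ 0); first by rewrite size_map size_iota size_nseq.
move=> i; rewrite size_map size_iota => lt_i.
by rewrite (nth_map 0) ?size_iota // !nth_iota // nth_nseq lt_i add0n addnK.
Qed.

Lemma seq_tau_seq1 (x : nat) : seq_tau [:: x] = [:: x].
Proof. by rewrite /seq_tau /= subn0. Qed.

Lemma seq_tau_rcons (s : seq nat) (x : nat) :
  seq_tau (rcons s x) = x - size s :: seq_tau s.
Proof.
rewrite /seq_tau size_rcons -addn1 iotaD map_cat rev_cat /= add0n.
rewrite nth_rcons ltnn eqxx; congr (_ :: rev _); apply/eq_in_map => k.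
by rewrite mem_iota /= add0n nth_rcons => ->.
Qed.

Lemma seq_tau_map_succn (s : seq nat) : sorted ltn s ->
  seq_tau (map succn s) = map succn (seq_tau s).
Proof.
move=> s_incr; rewrite /seq_tau map_rev size_map -map_comp; congr rev.
apply/eq_in_map => k; rewrite mem_iota add0n /= => lt_k.
by rewrite (nth_map 0) // subSn // leq_nth_increasing.
Qed.

Lemma seq_tau_cons0 (s : seq nat) :
  seq_tau (0 :: map succn s) = rcons (seq_tau s) 0.
Proof.
rewrite /seq_tau /= rev_cons size_map; congr (rcons (rev _) _).
rewrite -[1]/(1 + 0) iotaDl -map_comp; apply/eq_in_map => k.
by rewrite mem_iota add0n => lt_k; rewrite /= add1n /= (nth_map 0) // subSS.
Qed.

Lemma increasing_below_seq1 (n x : nat) : increasing_below n [:: x] = (x < n).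
Proof. by rewrite /increasing_below /= andbT. Qed.

Lemma increasing_below_iota (n x d : nat) :
  x + d <= n -> increasing_below n (iota x d).
Proof.
move=> le_n; rewrite /increasing_below iota_ltn_sorted; apply/allP => i.
by rewrite mem_iota inE; lia.
Qed.

Lemma increasing_below_filter (n : nat) (p : pred nat) (s : seq nat) :
  increasing_below n s -> increasing_below n (filter p s).
Proof.
case/andP=> s_incr lt_s; rewrite /increasing_below sorted_filter //=.
  by apply/allP => x; rewrite mem_filter => /andP[_ /(allP lt_s)].
by move=> y x z; apply: ltn_trans.
Qed.

Lemma increasing_belowW (m n : nat) (s : seq nat) :
  m <= n -> increasing_below m s -> increasing_below n s.
Proof.
move=> le_mn /andP[s_incr lt_s]; rewrite /increasing_below s_incr.
by apply: sub_all lt_s => x /= /leq_trans; apply.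
Qed.

Lemma increasing_below_rcons (n m : nat) (s : seq nat) :
  m < n -> increasing_below m s -> increasing_below n (rcons s m).
Proof.
move=> lt_mn /andP[s_incr /allP lt_s]; apply/andP; split; last first.
  rewrite all_rcons /= lt_mn; apply/allP => x /lt_s lt_xm.
  exact: ltn_trans lt_xm lt_mn.
case: s s_incr lt_s => //= x s s_incr lt_s; rewrite rcons_path s_incr.
exact/lt_s/mem_last.
Qed.

Lemma increasing_below_cons0 (n : nat) (s : seq nat) :
  increasing_below n s -> increasing_below n.+1 (0 :: map succn s).
Proof.
case/andP=> s_incr lt_s; rewrite /increasing_below /= all_map lt_s andbT.
have: sorted ltn (map succn s) by rewrite sorted_map.
by case: s {s_incr lt_s}.
Qed.

Lemma increasing_below_map_succn (n : nat) (s : seq nat) :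
  increasing_below n s -> increasing_below n.+1 (map succn s).
Proof. by rewrite /increasing_below sorted_map all_map. Qed.

Lemma size_disjoint_increasing (n : nat) (s t : seq nat) :
  increasing_below n s -> increasing_below n t -> ~~ has (mem s) t ->
  size s + size t <= n.
Proof.
case/andP=> s_incr lt_s /andP[t_incr lt_t] disj.
rewrite -size_cat -[n](size_iota 0); apply: uniq_leq_size.
  have lt_uniq (r : seq nat) : sorted ltn r -> uniq r.
    exact: (sorted_uniq ltn_trans ltnn).
  by rewrite cat_uniq disj !lt_uniq.
by move=> x; rewrite mem_cat mem_iota => /orP[/(allP lt_s)|/(allP lt_t)].
Qed.

Lemma seq_in_G_Weyl (n i j : nat) : i + j < n ->
  seq_in_G n [::] [:: i + j] [:: i] [::] [:: j] [::].
Proof.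
move=> lt_n; have [lt_i lt_j] : i < n /\ j < n by lia.
have tau_nil : tau_LR [::] [::] [::] by apply: LR_positive_nil.
have tau_nil1 x : tau_LR [:: x] [::] [:: x].
  by rewrite /tau_LR seq_tau_seq1; apply: LR_positive_nil.
have tau_add : tau_LR [:: j] [:: i] [:: i + j].
  by rewrite /tau_LR !seq_tau_seq1 addnC; apply: LR_positive_seq1.
split=> //; first by rewrite /= !increasing_below_seq1 lt_n lt_i lt_j.
exists [:: j], [:: i], [::], [::], [::], [::]; split=> //.
  by rewrite /= !increasing_below_seq1 lt_i lt_j.
by split=> //; apply: tau_LRC.
Qed.

Section Exchange.

Variables (n : nat) (s t : seq nat).
Hypotheses (s_n : increasing_below n s) (t_n : increasing_below n t).
Hypothesis s_t : ~~ has (mem s) t.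

Let t_s : ~~ has (mem t) s.
Proof. by rewrite has_sym. Qed.

Let le_n : size s + size t <= n.
Proof. exact: size_disjoint_increasing. Qed.

Let le_s : size s <= n.
Proof. exact: leq_trans (leq_addr _ _) le_n. Qed.

Let le_t : size t <= n.
Proof. exact: leq_trans (leq_addl _ _) le_n. Qed.

Let s_part : is_part (seq_tau s).
Proof. by apply: is_part_seq_tau; case/andP: s_n. Qed.

Let t_part : is_part (seq_tau t).
Proof. by apply: is_part_seq_tau; case/andP: t_n. Qed.

Lemma seq_in_G_exchange :
  seq_in_G n t s s t (iota 0 (size s + size t)) [::].
Proof.
split=> //; first by rewrite /= s_n t_n increasing_below_iota.
  by rewrite size_iota !addn0.
exists (iota 0 (size s)), s, t, (iota 0 (size t)), [::], [::]; split.
- by rewrite /= s_n t_n !increasing_below_iota.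
- split; split; rewrite ?size_iota // /tau_LR ?seq_tau_iota.
  + exact/LR_positiveC/LR_positive_nseq0.
  + exact: LR_positive_nseq0.
  + exact: LR_positive_nil.
- split; rewrite /tau_LR ?seq_tau_iota; last exact: LR_positive_zeros.
    exact: LR_positive_nil.
  exact/LR_positiveC/LR_positive_nil.
Qed.

Lemma seq_in_G_exchange_row :
  seq_in_G n.+1 (0 :: map succn t) (map succn s) (0 :: map succn s)
    (map succn t) (iota 1 (size s + size t)) [:: 0].
Proof.
have [/andP[s_incr _] /andP[t_incr _]] := (s_n, t_n).
have disjoint0 (r1 r2 : seq nat) : ~~ has (mem r2) r1 ->
    ~~ has (mem (0 :: map succn r1)) (map succn r2).
  move=> disj; rewrite has_sym /= has_map negb_or; apply/andP; split.
    by apply/mapP => -[].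
  by rewrite (eq_has (mem_map succn_inj r2)).
split.
- rewrite /= !increasing_below_cons0 ?increasing_below_map_succn //.
  by rewrite increasing_below_iota ?add1n.
- by split; rewrite ?disjoint0 //= mem_iota.
- by rewrite /= !size_map size_iota !addn1.
have sW := increasing_belowW (leqnSn n) s_n.
have tW := increasing_belowW (leqnSn n) t_n.
exists (iota 1 (size s)), s, t, (iota 1 (size t)), [:: 0], [:: 0]; split.
- by rewrite /= sW tW !increasing_below_iota.
- split; split; rewrite ?size_iota ?size_map // /tau_LR ?seq_tau_iota;
    rewrite ?seq_tau_map_succn // -?(size_seq_tau s) -?(size_seq_tau t).
  + exact/LR_positiveC/LR_positive_succn.
  + exact: LR_positive_succn.
  + exact: LR_positive_zeros 1 1 1.
- rewrite /tau_LR !seq_tau_cons0 !seq_tau_iota; split.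
  + exact: LR_positive_rcons0.
  + exact/LR_positiveC/LR_positive_rcons0.
  + exact: LR_positive_ones.
Qed.

Lemma seq_in_G_exchange_column N (m := size s + size t) :
  n < N -> 2 * n - m < N ->
  seq_in_G N (rcons t n) s (rcons s n) t (iota 0 m) [:: 2 * n - m].
Proof.
move=> lt_nN lt_N.
have notin r : increasing_below n r -> n \notin r.
  by case/andP=> _ /allP lt_r; apply/negP => /lt_r /=; rewrite ltnn.
have le_N k : k <= n -> k <= N by move/leq_ltn_trans/(_ lt_nN)/ltnW.
have lt_sub k : n - k < N := leq_ltn_trans (leq_subr k n) lt_nN.
have sN := increasing_belowW (ltnW lt_nN) s_n.
have tN := increasing_belowW (ltnW lt_nN) t_n.
split.
- rewrite /= !increasing_below_rcons // sN tN increasing_below_seq1 lt_N.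
  by rewrite increasing_below_iota ?le_N.
- split; last by rewrite has_seq1 /= mem_iota -leqNgt; lia.
    by rewrite has_sym has_rcons negb_or notin.
  by rewrite has_sym has_rcons negb_or notin.
- by rewrite !size_rcons size_iota !addn1.
exists (iota 0 (size s)), s, t, (iota 0 (size t)).
exists [:: n - size s], [:: n - size t]; split.
- rewrite /= sN tN !increasing_below_seq1 !lt_sub.
  by rewrite !increasing_below_iota ?le_N.
- split; split; rewrite ?size_iota // /tau_LR ?seq_tau_iota.
  + exact/LR_positiveC/LR_positive_nseq0.
  + exact: LR_positive_nseq0.
  + rewrite !seq_tau_seq1.
    have -> : 2 * n - m = (n - size s) + (n - size t) by rewrite /m; lia.
    exact: LR_positive_seq1.
- have n_part r : increasing_below n r -> is_part (n - size r :: seq_tau r).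
    move=> r_n; rewrite -seq_tau_rcons is_part_seq_tau //.
    by case/andP: (increasing_below_rcons lt_nN r_n).
  rewrite /tau_LR !seq_tau_rcons !seq_tau_iota !seq_tau_seq1.
  split; last exact: LR_positive_zeros.
    exact/LR_positive_cons/n_part.
  exact/LR_positiveC/LR_positive_cons/n_part.
Qed.

End Exchange.

(** * Consequences of the Horn inequalities *)

Definition exceedances (f g : nat -> nat) (m : nat) : seq nat :=
  [seq i <- iota 0 m | g i < f i].

Lemma increasing_below_exceedances (f g : nat -> nat) (m : nat) :
  increasing_below m (exceedances f g m).
Proof. exact/increasing_below_filter/increasing_below_iota. Qed.

Lemma exceedances_disjoint (f g : nat -> nat) (m : nat) :
  ~~ has (mem (exceedances f g m)) (exceedances g f m).
Proof.
apply/hasPn => i; rewrite mem_filter => /andP[lt_i _] /=.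
by rewrite mem_filter ltnNge (ltnW lt_i).
Qed.

Lemma size_exceedances (f g : nat -> nat) (m : nat) :
  size (exceedances f g m) + size (exceedances g f m)
    = \sum_(i < m) (f i != g i).
Proof.
rewrite -(sum_iota (fun i => f i != g i : nat)).
rewrite !size_filter -!sum1_count big_mkcond [X in _ + X]big_mkcond -big_split.
by apply: eq_bigr => i _ /=; case: ltngtP.
Qed.

Lemma sum_exceedances (f g : nat -> nat) (m : nat) :
  \sum_(i <- exceedances f g m) f i + \sum_(i <- exceedances g f m) g i
    + \sum_(i < m) minn (f i) (g i)
  = \sum_(i <- exceedances g f m) f i + \sum_(i <- exceedances f g m) g i
    + \sum_(i < m) maxn (f i) (g i).
Proof.
rewrite -!(sum_iota (fun i => _ (f i) (g i))).
rewrite !big_filter ![\sum_(_ <- _ | _) _]big_mkcond -!big_split.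
by apply: eq_bigr => i _ /=; case: ltngtP => [_|_|->]; lia.
Qed.

Lemma sum_minn_maxn (f g : nat -> nat) (m : nat) :
  \sum_(i < m) minn (f i) (g i) + \sum_(i < m) maxn (f i) (g i)
    = \sum_(i < m) f i + \sum_(i < m) g i.
Proof. by rewrite -!big_split; apply: eq_bigr => i _; apply: addn_min_max. Qed.

Lemma sum_maxn_neq (f g : nat -> nat) (m : nat) :
  (forall i, maxn (f i) (g i) <= (minn (f i) (g i)).+1) ->
  \sum_(i < m) maxn (f i) (g i)
    = \sum_(i < m) minn (f i) (g i) + \sum_(i < m) (f i != g i).
Proof.
move=> near; rewrite -big_split; apply: eq_bigr => i _ /=.
by have := near i; case: ltngtP; lia.
Qed.

Section HornBounds.

Variables (n : nat) (mu nu la : seq nat).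
Hypothesis horn : seq_Horn n mu nu la.

Lemma seq_Horn_Weyl i j : i + j < n -> mu`_(i + j) <= nu`_i + la`_j.
Proof.
by move=> /seq_in_G_Weyl/horn; rewrite !big_seq1 !big_nil; lia.
Qed.

Lemma seq_Horn_exchange m : m <= n ->
  \sum_(i < m) maxn mu`_i nu`_i <= \sum_(i < m) minn mu`_i nu`_i + sumn la.
Proof.
move=> le_mn; pose f := nth 0 mu; pose g := nth 0 nu.
have below_n h k : increasing_below n (exceedances h k m).
  exact/(increasing_belowW le_mn)/increasing_below_exceedances.
have /horn := seq_in_G_exchange (below_n f g) (below_n g f)
  (exceedances_disjoint f g m).
rewrite size_exceedances big_nil sum_iota.
have := sum_nth_leq_sumn la (\sum_(i < m) (f i != g i)).
by have := sum_exceedances f g m; rewrite /f /g; lia.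
Qed.

Lemma seq_Horn_exchange_column m (d := \sum_(i < m) (mu`_i != nu`_i)) :
  m < n -> 2 * m - d < n ->
  \sum_(i < m) maxn mu`_i nu`_i + la`_(2 * m - d)
    <= \sum_(i < m) minn mu`_i nu`_i + mu`_m + nu`_m + \sum_(i < d) la`_i.
Proof.
rewrite /d -(size_exceedances (nth 0 mu) (nth 0 nu)) => lt_m lt_n.
have /horn := seq_in_G_exchange_column (increasing_below_exceedances _ _ _)
  (increasing_below_exceedances _ _ _) (exceedances_disjoint _ _ _) lt_m lt_n.
have := sum_exceedances (nth 0 mu) (nth 0 nu) m.
by rewrite -!cats1 !big_cat !big_seq1 sum_iota /=; lia.
Qed.

Lemma seq_Horn_sum_minn m : m <= n ->
  (forall i, m <= i -> maxn mu`_i nu`_i = 0) ->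
  sumn mu + sumn nu <= 2 * \sum_(i < m) minn mu`_i nu`_i + sumn la.
Proof.
move=> le_mn max0; have := seq_Horn_exchange le_mn.
have := sum_minn_maxn (nth 0 mu) (nth 0 nu) m.
rewrite (@sumn_nth mu m) => [|i /max0]; last by lia.
by rewrite (@sumn_nth nu m) => [|i /max0]; lia.
Qed.

End HornBounds.

Lemma seq_Horn_exchange_row (n : nat) (mu nu la : seq nat) :
  seq_Horn n.+1 mu nu la ->
  la`_0 + \sum_(i < n) maxn mu`_i.+1 nu`_i.+1
    <= mu`_0 + nu`_0 + \sum_(i < n) minn mu`_i.+1 nu`_i.+1
       + \sum_(i < n) la`_i.+1.
Proof.
move=> horn; pose f i := mu`_i.+1; pose g i := nu`_i.+1.
have /horn := seq_in_G_exchange_row (increasing_below_exceedances f g n)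
  (increasing_below_exceedances g f n) (exceedances_disjoint f g n).
rewrite size_exceedances (iotaDl 1 0) (eq_map add1n).
rewrite !big_cons !big_map !big_nil sum_iota.
have := leq_sum_widen (fun i => la`_i.+1)
  (leq_sum_bool (fun i => f i != g i) n).
by have := sum_exceedances f g n; rewrite /f /g /=; lia.
Qed.

(** * Common strips *)

Lemma exists_part_between (n m t : nat) (lo hi : nat -> nat) : m <= n ->
  (forall i, lo i <= hi i) -> (forall i, lo i.+1 <= lo i) ->
  (forall i, hi i.+1 <= hi i) -> (forall i, m <= i -> hi i = 0) ->
  \sum_(i < m) lo i <= t <= \sum_(i < m) hi i ->
  exists al : seq nat, [/\ size al = n, is_part al,
    forall i, lo i <= al`_i <= hi i & sumn al = t].
Proof.
move=> le_mn le_lh lo_dec hi_dec hi0 /andP[le_lo le_hi].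
(* The cells between [lo] and [hi] are added greedily from the top row. *)
pose gap k := \sum_(i < k) (hi i - lo i); pose r := t - \sum_(i < m) lo i.
pose x i := lo i + minn (hi i - lo i) (r - gap i).
have gapS k : gap k.+1 = gap k + (hi k - lo k).
  exact: (sum_ord_recr (fun i => hi i - lo i)).
have sum_x k : \sum_(i < k) x i = \sum_(i < k) lo i + minn (gap k) r.
  elim: k => [|k IH]; first by rewrite /gap !big_ord0 min0n.
  by rewrite !sum_ord_recr IH gapS /x; lia.
have gap_m : gap m + \sum_(i < m) lo i = \sum_(i < m) hi i.
  by rewrite -big_split; apply: eq_bigr => i _; apply: subnK.
have x_lh i : lo i <= x i <= hi i by rewrite /x; have := le_lh i; lia.
have x_dec i : x i.+1 <= x i.
  rewrite /x gapS; have := le_lh i; have := le_lh i.+1.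
  by have := lo_dec i; have := hi_dec i; lia.
have x0 i : m <= i -> x i = 0 by move/hi0=> hi_i; have := x_lh i; lia.
have nth_x i : (mkseq x n)`_i = x i.
  case: (ltnP i n) => [lt_in|le_ni]; first by rewrite nth_mkseq.
  by rewrite nth_default ?size_mkseq // x0 // (leq_trans le_mn).
exists (mkseq x n); split; first by rewrite size_mkseq.
- by apply/is_partP => i; rewrite !nth_x.
- by move=> i; rewrite nth_x.
rewrite (@sumn_nth _ m) => [|i /x0]; last by rewrite nth_x.
rewrite (eq_bigr (fun i : 'I_m => x i)) => [|i _]; last by rewrite nth_x.
by rewrite sum_x /r; lia.
Qed.

Lemma exists_half_part_between (n m p q : nat) (lo hi : nat -> nat) : m <= n ->
  (forall i, lo i <= hi i) -> (forall i, lo i.+1 <= lo i) ->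
  (forall i, hi i.+1 <= hi i) -> (forall i, m <= i -> hi i = 0) ->
  ~~ odd (q + p) ->
  2 * \sum_(i < m) lo i + p <= q <= 2 * \sum_(i < m) hi i + p ->
  exists al : seq nat, [/\ size al = n, is_part al,
    forall i, lo i <= al`_i <= hi i & 2 * sumn al + p = q].
Proof.
move=> le_mn le_lh lo_dec hi_dec hi0 even bounds.
have [t qE] : exists t, q = 2 * t + p.
  by exists (q - p)./2; move: even bounds; lia.
have t_bounds : \sum_(i < m) lo i <= t <= \sum_(i < m) hi i by lia.
have [al [al_n al_part al_lh al_t]] :=
  exists_part_between le_mn le_lh lo_dec hi_dec hi0 t_bounds.
by exists al; split; rewrite ?al_t.
Qed.

Lemma exists_common_length (n : nat) (s t : seq nat) :
  size s = n -> size t = n -> is_part s -> is_part t ->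
  exists2 m, m <= n & forall i, (m <= i) = (maxn s`_i t`_i == 0).
Proof.
move=> s_n t_n s_part t_part; pose zero i := maxn s`_i t`_i == 0.
have zero_n i : n <= i -> zero i.
  by move=> le_ni; rewrite /zero !nth_default ?s_n ?t_n.
have zero_mono i j : i <= j -> zero i -> zero j.
  move=> le_ij; rewrite /zero; have := is_part_nth s_part le_ij.
  by have := is_part_nth t_part le_ij; lia.
have find_leq k := find_iota_leq zero_mono (zero_n _ (leqnn n)) (k := k).
exists (find zero (iota 0 n.+1)) => [|i]; first by rewrite find_leq ?zero_n.
case: (leqP i n) => [/find_leq //|/ltnW le_ni]; rewrite -/(zero i) zero_n //.
by rewrite (leq_trans _ le_ni) // find_leq ?zero_n.
Qed.

Section CommonStrips.

Variables (n : nat) (mu nu la : seq nat).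
Hypotheses (mu_n : size mu = n) (nu_n : size nu = n).
Hypothesis horn : seq_Horn n mu nu la.

Let nth_over (s : seq nat) i : size s = n -> n <= i -> s`_i = 0.
Proof. by move=> s_n le_ni; rewrite nth_default ?s_n. Qed.

Lemma seq_Horn_interlace i : is_row la ->
  mu`_i.+1 <= nu`_i /\ nu`_i.+1 <= mu`_i.
Proof.
move=> la_row; case: (ltnP i.+1 n) => [lt_i|le_i]; last first.
  by rewrite (nth_over mu_n le_i) (nth_over nu_n le_i).
rewrite -addn1 in lt_i; have := seq_Horn_Weyl horn lt_i.
by have := seq_Horn_Weyl (seq_Horn_swap horn) lt_i; rewrite la_row !addn0 addn1.
Qed.

Lemma seq_Horn_sum_maxn_row : 0 < n -> is_row la ->
  2 * \sum_(i < n) maxn mu`_i.+1 nu`_i.+1 + sumn la <= sumn mu + sumn nu.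
Proof.
case: n mu_n nu_n horn => [//|k] mu_k nu_k horn_k _ la_row.
have sum_split s : size s = k.+1 -> sumn s = s`_0 + \sum_(i < k) s`_i.+1.
  by move=> s_k; rewrite (@sumn_nth_sub s s k.+1) ?s_k // big_ord_recl.
have max_k : maxn mu`_k.+1 nu`_k.+1 = 0.
  by rewrite !nth_default ?mu_k ?nu_k.
have la_tail : \sum_(i < k) la`_i.+1 = 0 by rewrite big1.
have := seq_Horn_exchange_row horn_k.
have := sum_minn_maxn (fun i => mu`_i.+1) (fun i => nu`_i.+1) k.
rewrite (sumn_row la_row) !sum_split // la_tail.
by rewrite (sum_ord_recr (fun i => maxn mu`_i.+1 nu`_i.+1)) max_k; lia.
Qed.

Lemma seq_Horn_maxn_leq i : is_column la ->
  maxn mu`_i nu`_i <= (minn mu`_i nu`_i).+1.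
Proof.
move=> la_col; case: (ltnP i n) => [lt_i|le_i]; last by rewrite !nth_over.
rewrite -[i]addn0 in lt_i; have := seq_Horn_Weyl (seq_Horn_swap horn) lt_i.
by have := seq_Horn_Weyl horn lt_i; rewrite la_col addn0; lia.
Qed.

(* A higher column [la] would have a box in row [2 * m - d], where [d] is the
   number of disagreements, against [seq_Horn_exchange_column]. *)
Lemma seq_Horn_column_height m : is_column la -> size la = n ->
  m <= n -> mu`_m = 0 -> nu`_m = 0 ->
  sumn la + \sum_(i < m) (mu`_i != nu`_i) <= 2 * m.
Proof.
move=> la_col la_n le_mn mu_m nu_m; set d := \sum_(i < m) _.
have le_dm : d <= m := leq_sum_bool (fun i => mu`_i != nu`_i) m.
have le_la : sumn la <= n by rewrite -la_n leq_sumn_size_column.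
rewrite leqNgt; apply/negP => lt_la.
have lt_n : 2 * m - d < n by lia.
have lt_m : m < n by lia.
have := seq_Horn_exchange_column horn lt_m lt_n; rewrite -/d mu_m nu_m la_col.
have sum_la : \sum_(i < d) la`_i <= d.
  under eq_bigr do rewrite la_col.
  exact: (leq_sum_bool (fun i => i < sumn la)).
by rewrite sum_maxn_neq -/d => [|i]; [lia | exact: seq_Horn_maxn_leq].
Qed.

Lemma seq_Horn_sum_maxn_column m : is_column la -> size la = n -> m <= n ->
  (forall i, (m <= i) = (maxn mu`_i nu`_i == 0)) ->
  2 * \sum_(i < m) (maxn mu`_i nu`_i).-1 + sumn la <= sumn mu + sumn nu.
Proof.
move=> la_col la_n le_mn max0.
have zero i : m <= i -> mu`_i = 0 /\ nu`_i = 0.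
  by rewrite max0 -leqn0 geq_max !leqn0 => /andP[/eqP-> /eqP->].
have [mu_m nu_m] := zero m (leqnn m).
have sum_pred : \sum_(i < m) (maxn mu`_i nu`_i).-1 + m
    = \sum_(i < m) maxn mu`_i nu`_i.
  rewrite -[X in _ + X](card_ord m) -sum1_card -big_split.
  by apply: eq_bigr => i _ /=; rewrite addn1 prednK // lt0n -max0 -ltnNge.
have := seq_Horn_column_height la_col la_n le_mn mu_m nu_m.
have := sum_minn_maxn (nth 0 mu) (nth 0 nu) m.
have := sum_maxn_neq m (fun i => seq_Horn_maxn_leq i la_col).
rewrite (@sumn_nth mu m) => [|i /zero[]//].
by rewrite (@sumn_nth nu m) => [|i /zero[]//]; lia.
Qed.

Hypotheses (mu_part : is_part mu) (nu_part : is_part nu).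
Hypothesis even : ~~ odd (sumn mu + sumn nu + sumn la).

Let mu_dec i : mu`_i.+1 <= mu`_i.
Proof. exact: is_part_nth. Qed.

Let nu_dec i : nu`_i.+1 <= nu`_i.
Proof. exact: is_part_nth. Qed.

Let hi i := minn mu`_i nu`_i.

Let hi_dec i : hi i.+1 <= hi i.
Proof. by rewrite /hi leq_min !geq_min mu_dec nu_dec orbT. Qed.

Lemma exists_common_horizontal_strip : 0 < n -> is_row la ->
  exists al : seq nat, [/\ size al = n, is_part al,
    horizontal_strip (nth 0 al) (nth 0 mu),
    horizontal_strip (nth 0 al) (nth 0 nu)
    & 2 * sumn al + sumn la = sumn mu + sumn nu].
Proof.
move=> n_gt0 la_row; pose lo i := maxn mu`_i.+1 nu`_i.+1.
have le_lh i : lo i <= hi i.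
  rewrite /lo /hi leq_min !geq_max mu_dec nu_dec.
  by case: (seq_Horn_interlace i la_row) => -> ->.
have lo_dec i : lo i.+1 <= lo i.
  by rewrite /lo geq_max !leq_max mu_dec nu_dec orbT.
have hi0 i : n <= i -> hi i = 0 by move=> le_ni; rewrite /hi !nth_over.
have max0 i : n <= i -> maxn mu`_i nu`_i = 0 by move=> le_ni; rewrite !nth_over.
have bounds : 2 * \sum_(i < n) lo i + sumn la <= sumn mu + sumn nu
    <= 2 * \sum_(i < n) hi i + sumn la.
  by rewrite seq_Horn_sum_maxn_row //= (seq_Horn_sum_minn horn).
have [al [al_n al_part al_lh sumE]] :=
  exists_half_part_between (leqnn n) le_lh lo_dec hi_dec hi0 even bounds.
by exists al; split=> // i; have := al_lh i; rewrite /lo /hi; lia.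
Qed.

Lemma exists_common_vertical_strip : is_column la -> size la = n ->
  exists al : seq nat, [/\ size al = n, is_part al,
    vertical_strip (nth 0 al) (nth 0 mu), vertical_strip (nth 0 al) (nth 0 nu)
    & 2 * sumn al + sumn la = sumn mu + sumn nu].
Proof.
move=> la_col la_n; pose lo i := (maxn mu`_i nu`_i).-1.
have [m le_mn max0] :=
  exists_common_length mu_n nu_n mu_part nu_part.
have le_lh i : lo i <= hi i.
  by have := seq_Horn_maxn_leq i la_col; rewrite /lo /hi; lia.
have lo_dec i : lo i.+1 <= lo i.
  by have := mu_dec i; have := nu_dec i; rewrite /lo; lia.
have max_m0 i : m <= i -> maxn mu`_i nu`_i = 0 by rewrite max0 => /eqP.
have hi0 i : m <= i -> hi i = 0 by move/max_m0; rewrite /hi; lia.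
have bounds : 2 * \sum_(i < m) lo i + sumn la <= sumn mu + sumn nu
    <= 2 * \sum_(i < m) hi i + sumn la.
  by rewrite seq_Horn_sum_maxn_column //= (seq_Horn_sum_minn horn).
have [al [al_n al_part al_lh sumE]] :=
  exists_half_part_between le_mn le_lh lo_dec hi_dec hi0 even bounds.
by exists al; split=> // i; have := al_lh i; rewrite /lo /hi; lia.
Qed.

End CommonStrips.

Definition row_part (n p : nat) : seq nat := p :: nseq n.-1 0.

Definition column_part (n k : nat) : seq nat := nseq k 1 ++ nseq (n - k) 0.

Lemma size_row_part (n p : nat) : 0 < n -> size (row_part n p) = n.
Proof. by move=> n_gt0; rewrite /= size_nseq prednK. Qed.

Lemma sumn_row_part (n p : nat) : sumn (row_part n p) = p.
Proof. by rewrite /= sumn_nseq mul0n addn0. Qed.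

Lemma is_row_row_part (n p : nat) : is_row (row_part n p).
Proof. by move=> i; rewrite /= nth_nseq if_same. Qed.

Lemma size_column_part (n k : nat) : k <= n -> size (column_part n k) = n.
Proof. by move=> le_kn; rewrite size_cat !size_nseq subnKC. Qed.

Lemma sumn_column_part (n k : nat) : sumn (column_part n k) = k.
Proof. by rewrite sumn_cat !sumn_nseq mul0n mul1n addn0. Qed.

Lemma is_column_column_part (n k : nat) : is_column (column_part n k).
Proof.
move=> i; rewrite sumn_column_part nth_cat size_nseq !nth_nseq.
by case: ltnP => // _; rewrite if_same.
Qed.

Section WitnessOfStrip.

Variables (n : nat) (mu nu la al : seq nat).
Hypotheses (mu_part : is_part mu) (nu_part : is_part nu).
Hypotheses (al_n : size al = n) (al_part : is_part al).
Hypothesis sumE : 2 * sumn al + sumn la = sumn mu + sumn nu.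

Let p := sumn mu - sumn al.
Let q := sumn nu - sumn al.

Lemma NL_witness_horizontal_strip : 0 < n -> is_row la ->
  horizontal_strip (nth 0 al) (nth 0 mu) ->
  horizontal_strip (nth 0 al) (nth 0 nu) -> NL_witness n mu nu la.
Proof.
move=> n_gt0 la_row al_mu al_nu.
have le_mu := leq_sumn_sub (fun i => horizontal_strip_leq i al_mu).
have le_nu := leq_sumn_sub (fun i => horizontal_strip_leq i al_nu).
have [p_row q_row] := (is_row_row_part n p, is_row_row_part n q).
exists al, (row_part n p), (row_part n q); split.
- by rewrite !size_row_part.
- by split=> //; apply: is_part_row.
have pq : p + q = sumn la by rewrite /p /q; lia.
split.
- by apply: Pieri_row; rewrite ?sumn_row_part ?subnKC.
- by apply: Pieri_row; rewrite ?sumn_row_part ?subnKC.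
apply: Pieri_row; rewrite ?sumn_row_part //; first exact: is_part_row.
by case=> [|i]; rewrite ?la_row ?p_row //= -(sumn_row la_row) -pq leq_addr.
Qed.

Lemma NL_witness_vertical_strip : size la = n -> is_column la ->
  vertical_strip (nth 0 al) (nth 0 mu) ->
  vertical_strip (nth 0 al) (nth 0 nu) -> NL_witness n mu nu la.
Proof.
move=> la_n la_col al_mu al_nu.
have le_mu := leq_sumn_sub (fun i => vertical_strip_leq i al_mu).
have le_nu := leq_sumn_sub (fun i => vertical_strip_leq i al_nu).
have le_la : sumn la <= n by rewrite -la_n leq_sumn_size_column.
have pq : p + q = sumn la by rewrite /p /q; lia.
have [p_col q_col] := (is_column_column_part n p, is_column_column_part n q).
exists al, (column_part n p), (column_part n q); split.
- by rewrite !size_column_part //; lia.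
- by split=> //; apply: is_part_column.
split.
- by apply: Pieri_column; rewrite ?sumn_column_part ?subnKC.
- by apply: Pieri_column; rewrite ?sumn_column_part ?subnKC.
apply: Pieri_column; rewrite ?sumn_column_part //; first exact: is_part_column.
  exact: is_part_column.
by move=> i; rewrite la_col p_col sumn_column_part -pq; lia.
Qed.

End WitnessOfStrip.

Lemma seq_Horn_NL_witness (n : nat) (mu nu la : n.-tuple nat) : 0 < n ->
  is_part mu -> is_part nu -> ~~ odd (sumn mu + sumn nu + sumn la) ->
  seq_Horn n mu nu la -> single_row la \/ single_column la ->
  NL_witness n mu nu la.
Proof.
move=> n_gt0 mu_part nu_part even horn.
have [mu_n nu_n la_n] := And3 (size_tuple mu) (size_tuple nu) (size_tuple la).
case=> [[p laE]|[k _ laE]].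
  have la_row : is_row la by rewrite laE; apply: is_row_row_part.
  have [al [al_n al_part al_mu al_nu sumE]] :=
    exists_common_horizontal_strip mu_n nu_n horn mu_part nu_part even
      n_gt0 la_row.
  exact: NL_witness_horizontal_strip sumE n_gt0 la_row al_mu al_nu.
have la_col : is_column la by rewrite laE; apply: is_column_column_part.
have [al [al_n al_part al_mu al_nu sumE]] :=
  exists_common_vertical_strip mu_n nu_n horn mu_part nu_part even
    la_col la_n.
exact: NL_witness_vertical_strip sumE la_n la_col al_mu al_nu.
Qed.

Theorem theorem1p5 (n : nat) (mu nu la : n.-tuple nat) :
  0 < n ->
  is_part mu -> is_part nu -> is_part la ->
  ~~ odd (sumn mu + sumn nu + sumn la) ->
  (forall A A' B B' C C' : {set 'I_n}, in_G A A' B B' C C' ->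
     (0 <= sum_on A mu - sum_on A' mu + sum_on B nu - sum_on B' nu
           + sum_on C la - sum_on C' la)%R) ->
  [\/ single_row mu \/ single_column mu,
      single_row nu \/ single_column nu
    | single_row la \/ single_column la] ->
  0 < NL mu nu la.
Proof.
move=> n_gt0 mu_part nu_part la_part even /extended_Horn_seq horn special.
have horn_rot := seq_Horn_rot horn; apply: NL_witness_gt0 => //.
case: special => special.
- apply/NL_witness_rot/NL_witness_rot; apply: seq_Horn_NL_witness => //.
    by rewrite addnC addnA.
  exact: seq_Horn_rot.
- apply/NL_witness_rot; apply: seq_Horn_NL_witness => //.
  by rewrite -addnA addnC.
- exact: seq_Horn_NL_witness.
Qed.
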